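(* Let $1\le p,q\le\infty$ with $\frac1p+\frac1q\ge1$, let $X_1,\dots,X_n,Y$ be Banach spaces and let $\zeta$ be a linear functional on $X_1\otimes\dots\otimes X_n\otimes Y$. The following are equivalent: (i) $\zeta$ is a bounded linear functional on $(X_1\otimes\dots\otimes X_n\otimes Y,\alpha_{p,q}^\pi)$. (ii) For any $w^*$-compact norming subsets $K\subset B_{\mathcal L(X_1,\dots,X_n)}$ and $L\subset B_{Y^*}$ there exist a nonnegative constant $C$ and regular Borel probability measures $\mu$ and $\nu$ on $K$ and $L$ respectively such that for all decomposable tensors $a,b$ in $X_1\otimes\dots\otimes X_n$ and all $y\in Y$ $$|\langle\zeta,(a-b)\otimes y\rangle|\le C\left(\int_K|f_\psi(a)-f_\psi(b)|^{q^*}d\mu(\psi)\right)^{\frac1{q^*}}\left(\int_L|y^*(y)|^{p^*}d\nu(y^* )\right)^{\frac1{p^*}}$$ (where the first integral factor is replaced by $\pi(a-b)$ if $q=1$ and the second by $\|y\|$ if $p=1$). Under these circumstances $\|\zeta\|=\inf C$, the infimum being over all constants $C$ as in (ii) (for any given $K$ and $L$).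
   Context: All Banach spaces are over the same field $\mathbb K\in\{\mathbb R,\mathbb C\}$; $s^*$ is the conjugate exponent of $s\in[1,\infty]$; $B_X$ is the closed unit ball. $\Sigma_{X_1\dots X_n}=\{x^1\otimes\dots\otimes x^n: x^i\in X_i\}$ is the set of decomposable tensors of the algebraic tensor product $X_1\otimes\dots\otimes X_n$, and $\pi$ is the projective tensor norm. $\mathcal L(X_1,\dots,X_n)$ is the Banach space of bounded multilinear forms with the sup norm, identified with the dual of the completed projective tensor product (which defines its $w^*$-topology). For $\psi\in\mathcal L(X_1,\dots,X_n)$, $f_\psi$ is the restriction to $\Sigma_{X_1\dots X_n}$ of its linearization, so $f_\psi(x^1\otimes\dots\otimes x^n)=\psi(x^1,\dots,x^n)$. A (nonempty) subset of the unit ball of a dual space $E^*$ is norming if $\|e\|$ equals the supremum of $|e^*(e)|$ over $e^*$ in the subset for every $e\in E$ (for $K$, $E$ is the projective tensor product of $X_1,\dots,X_n$; for $L$, $E=Y$). For finite sequences $(a_i)_{i=1}^m,(b_i)_{i=1}^m$ in $\Sigma_{X_1\dots X_n}$ and $(y_i)_{i=1}^m$ in $Y$: $\|(a_i-b_i)_{i=1}^m\|_s^{w,\pi}=\sup_{\varphi\in B_{\mathcal L(X_1,\dots,X_n)}}\big(\sum_i|f_\varphi(a_i)-f_\varphi(b_i)|^s\big)^{1/s}$ and $\|(y_i)_{i=1}^m\|_s^w=\sup_{y^*\in B_{Y^*}}\big(\sum_i|y^*(y_i)|^s\big)^{1/s}$ (maxima over $i$ if $s=\infty$). With $r\in[1,\infty]$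 determined by $1=\frac1r+\frac1{q^*}+\frac1{p^*}$, the Laprest\'e norm on $X_1\otimes\dots\otimes X_n\otimes Y$ is $$\alpha_{p,q}^\pi(u)=\inf\Big\{\|(\lambda_i)_{i=1}^m\|_r\,\|(a_i-b_i)_{i=1}^m\|_{q^*}^{w,\pi}\,\|(y_i)_{i=1}^m\|_{p^*}^w : u=\sum_{i=1}^m\lambda_i(a_i-b_i)\otimes y_i\Big\},$$ the infimum over all representations with $\lambda_i\in\mathbb K$, $a_i,b_i\in\Sigma_{X_1\dots X_n}$, $y_i\in Y$. *)

(* Defs.v *)
From HB Require Import structures.
From mathcomp Require Import all_boot all_order all_algebra.
From mathcomp Require Import complex lra.
From mathcomp Require Import all_classical all_reals all_analysis.

Set Implicit Arguments.
Unset Strict Implicit.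
Unset Printing Implicit Defensive.

Import Order.TTheory GRing.Theory Num.Theory.
Import numFieldNormedType.Exports.

Local Open Scope classical_set_scope.
Local Open Scope ring_scope.

(* [scalars R k] is R or C; norms over it take values in [scalars R k], and [nrm]
   reads them as elements of [R]. *)
Variant field_kind := RealScalars | ComplexScalars.

Definition scalars (R : realType) (k : field_kind) : numFieldType :=
  match k with
  | RealScalars => R
  | ComplexScalars => R[i]
  end.

Definition scalars_re (R : realType) (k : field_kind) : scalars R k -> R :=
  match k return scalars R k -> R with
  | RealScalars => fun x => x
  | ComplexScalars => fun z => complex.Re z
  end.

Definition nrm (R : realType) (k : field_kind) (V : normedZmodType (scalars R k))
  (v : V) : R := scalars_re `|v|.

Section Tensor.
Variables (K : fieldType) (A : Type) (P : set (A -> K)).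

(* The elements of [tensor] are the finite linear combinations of the
   evaluation functionals [f |-> f x] on the forms satisfying [P].  For [P] the
   multilinear (bilinear) forms this is the usual model of the algebraic tensor
   product, with [tens x] the elementary tensors. *)
Definition form_on : Type := set_type P.

Definition eval_form (x : A) : form_on -> K^o := fun f => set_val f x.

Definition eval_span : {pred form_on -> K^o} :=
  fun u => `[< exists s : seq (K * A),
    u = \sum_(c <- s) c.1 *: eval_form c.2 >].

Lemma eval_span_closed : submod_closed eval_span.
Proof.
split; first by apply/asboolP; exists [::]; rewrite big_nil.
move=> a u v /asboolP[s ->] /asboolP[t ->]; apply/asboolP.
exists ([seq (a * c.1, c.2) | c <- s] ++ t).
rewrite big_cat big_map scaler_sumr; congr (_ + _).
by apply: eq_bigr => c _; rewrite scalerA.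
Qed.

HB.instance Definition _ := GRing.isSubmodClosed.Build K
  (form_on -> K^o) eval_span eval_span_closed.

Record tensor : Type := Tensor {
  tensor_val : form_on -> K^o;
  tensor_valP : tensor_val \in eval_span }.

HB.instance Definition _ := [isSub for tensor_val].
HB.instance Definition _ := [Choice of tensor by <:].
HB.instance Definition _ := [SubChoice_isSubLmodule of tensor by <:].

Lemma eval_form_span (x : A) : eval_form x \in eval_span.
Proof. by apply/asboolP; exists [:: (1, x)]; rewrite big_seq1 scale1r. Qed.

Definition tens (x : A) : tensor := Tensor (eval_form_span x).

Definition linearize (f : form_on) (u : tensor) : K := tensor_val u f.

Lemma linearize_tens (f : form_on) (x : A) : linearize f (tens x) = set_val f x.
Proof. by []. Qed.

Lemma linearizeP (f : form_on) : linear (linearize f : tensor -> K^o).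
Proof. by []. Qed.

Lemma tensor_gen (u : tensor) :
  exists s : seq (K * A), u = \sum_(c <- s) c.1 *: tens c.2.
Proof.
case: u => u uP; have /asboolP[s us] := uP.
exists s; apply: val_inj; rewrite raddf_sum/= us.
by apply: eq_bigr.
Qed.

End Tensor.

Arguments tens {K A} P x.

Definition multilinear_forms (K : fieldType) (I : finType)
    (X : I -> lmodType K) : set ((forall i, X i) -> K) :=
  [set f | forall (x : forall i, X i) (i : I) (c : K) (u v : X i),
     f (dfwith x i (c *: u + v)) = c * f (dfwith x i u) + f (dfwith x i v)].
Arguments multilinear_forms {K I} X _.

Definition bilinear_forms (K : fieldType) (E F : lmodType K) :
    set (E * F -> K) :=
  [set f | (forall y, linear ((fun x => f (x, y)) : E -> K^o)) /\
           (forall x, linear ((fun y => f (x, y)) : F -> K^o))].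
Arguments bilinear_forms {K} E F _.

Section ProjectiveTensor.
Context {R : realType} {k : field_kind} {n : nat}.
Variable X : 'I_n -> completeNormedModType (scalars R k).
Local Notation K := (scalars R k).

Definition mforms : set ((forall i, X i) -> K) :=
  multilinear_forms (fun i => X i : lmodType K).

Definition mtensor : lmodType K := tensor mforms.

Definition mtens (x : forall i, X i) : mtensor := tens mforms x.

Lemma mtens_multilinear (x : forall i, X i) (i : 'I_n) (c : K) (u v : X i) :
  mtens (dfwith x i (c *: u + v)) =
  c *: mtens (dfwith x i u) + mtens (dfwith x i v).
Proof.
by apply: val_inj; apply/funext => -[f fP]; have := set_mem fP; exact.
Qed.

Definition decomposable : set mtensor := range mtens.

Definition proj_norm (u : mtensor) : \bar R := ereal_inf
  [set t | exists (m : nat) (x : 'I_m -> forall i, X i),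
     u = \sum_(j < m) mtens (x j) /\
     t = (\sum_(j < m) \prod_(i < n) nrm (x j i))%:E].

Definition mnorm (f : form_on mforms) : \bar R := ereal_sup
  [set (nrm (set_val f x))%:E | x in [set x | forall i, nrm (x i) <= 1]].

Definition bounded_mforms : set (form_on mforms) :=
  [set f | (mnorm f < +oo)%E].

(* The Banach space L(X_1, ..., X_n) and the action f_psi on tensors. *)
Definition mdual : choiceType := set_type bounded_mforms.

Definition mpair (psi : mdual) (u : mtensor) : K := linearize (set_val psi) u.

Definition mball : set mdual := [set psi | (mnorm (set_val psi) <= 1)%E].

(* The completed projective tensor product is represented by the Cauchy
   sequences for [proj_norm]; sequences at distance 0 are not identified, which
   changes neither the weak* topology nor the norming sets. *)
Definition proj_cauchy : set (nat -> mtensor) :=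
  [set u | forall e : R, 0 < e -> exists N : nat, forall i j : nat,
     (N <= i)%N -> (N <= j)%N -> (proj_norm (u i - u j) < e%:E)%E].

Definition ctensor : Type := set_type proj_cauchy.

Definition cnorm (u : ctensor) : \bar R :=
  lim ((fun j => proj_norm (set_val u j)) @ \oo).

Definition cpair (psi : mdual) (u : ctensor) : K^o :=
  lim ((fun j => (mpair psi (set_val u j) : K^o)) @ \oo).

End ProjectiveTensor.

Arguments mball {R k n} X _.
Arguments cnorm {R k n} X u.
Arguments cpair {R k n} X psi u.

Section Dual.
Context {R : realType} {k : field_kind}.
Variable Y : completeNormedModType (scalars R k).
Local Notation K := (scalars R k).

Definition bdual : choiceType :=
  set_type [set f : Y -> K^o | linear f /\ continuous f].

Definition bdual_pair (f : bdual) (y : Y) : K^o := set_val f y.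

Definition bdual_ball : set bdual :=
  [set f | (ereal_sup [set (nrm (bdual_pair f y))%:E | y in [set y | nrm y <= 1]%R]
            <= 1)%E].

End Dual.

Arguments bdual_pair {R k} Y f y.
Arguments bdual_ball {R k} Y _.

(* The weak* topology on [E'] coming from the pairing with [E]. *)
Definition wstar (K : numFieldType) (E' : choiceType) (E : Type)
    (pairing : E' -> E -> K^o) : topologicalType :=
  initial_topology (pairing : E' -> {ptws E -> K^o}).

Definition norming (R : realType) (k : field_kind) (E' E : Type)
    (pairing : E' -> E -> scalars R k) (normE : E -> \bar R) (A : set E') : Prop :=
  A !=set0 /\
  forall e, normE e = ereal_sup [set (nrm (pairing f e))%:E | f in A].

(* Measurable types are pointed in the library, hence the nonemptiness proof
   carried by the subspace type. *)
Definition subspace_of (T : topologicalType) (A : set T) (A0 : A !=set0) :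
  Type := set_type A.

Lemma subspace_of_point (T : topologicalType) (A : set T) (A0 : A !=set0) :
  subspace_of A0.
Proof. by have [x Ax] := cid A0; exists x; exact: mem_set. Qed.

HB.instance Definition _ (T : topologicalType) (A : set T) (A0 : A !=set0) :=
  Topological.copy (subspace_of A0) (set_type A).
HB.instance Definition _ (T : topologicalType) (A : set T) (A0 : A !=set0) :=
  isPointed.Build (subspace_of A0) (subspace_of_point A0).

Definition borel_of (S : ptopologicalType) := g_sigma_algebraType (@open S).

Definition regular_measure (R : realType) (S : ptopologicalType)
    (mu : probability (borel_of S) R) : Prop :=
  forall A : set S, measurable (A : set (borel_of S)) ->
    mu A = ereal_inf [set mu U | U in [set U : set S | open U /\ A `<=` U]] /\
    mu A = ereal_sup [set mu F | F in [set F : set S | compact F /\ F `<=` A]].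

Section Laprest.
Context {R : realType} {k : field_kind}.
Local Notation K := (scalars R k).
Local Notation "p ^*" := (hoelder_conjugate p) : ereal_scope.

Definition lnorm (s : \bar R) (m : nat) (v : 'I_m -> K) : R :=
  match s with
  | s%:E => (\sum_(i < m) nrm (v i) `^ s) `^ s^-1
  | +oo%E => \big[Order.max/0]_(i < m) nrm (v i)
  | -oo%E => 0
  end.

Section Weak.
Context {n : nat} {X : 'I_n -> completeNormedModType K}
  {Y : completeNormedModType K}.

Definition weak_lnorm_tensor (s : \bar R) (m : nat)
    (a b : 'I_m -> mtensor X) : \bar R :=
  ereal_sup [set (lnorm s (fun i => mpair phi (a i) - mpair phi (b i)))%:E
            | phi in mball X].

Definition weak_lnorm (s : \bar R) (m : nat) (y : 'I_m -> Y) : \bar R :=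
  ereal_sup [set (lnorm s (fun i => bdual_pair Y f (y i)))%:E | f in bdual_ball Y].

End Weak.

Context {n : nat}.
Variables (X : 'I_n -> completeNormedModType K) (Y : completeNormedModType K).

Definition tensorY : lmodType K := tensor (bilinear_forms (mtensor X) Y).

Definition tensY (u : mtensor X) (y : Y) : tensorY :=
  tens (bilinear_forms (mtensor X) Y) (u, y).

Lemma tensY_linearl (y : Y) (c : K) (u v : mtensor X) :
  tensY (c *: u + v) y = c *: tensY u y + tensY v y.
Proof.
apply: val_inj; apply/funext => -[f fP]; have [fl _] := set_mem fP.
exact: fl.
Qed.

Lemma tensY_linearr (u : mtensor X) (c : K) (y z : Y) :
  tensY u (c *: y + z) = c *: tensY u y + tensY u z.
Proof.
apply: val_inj; apply/funext => -[f fP]; have [_ fr] := set_mem fP.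
exact: fr.
Qed.

(* The solution r of 1 = 1/r + 1/q^* + 1/p^*, with the convention 1/0 = +oo. *)
Definition lapreste_index (p q : \bar R) : \bar R :=
  ((1 - ((q^*)^-1 + (p^*)^-1))^-1)%E.

Lemma lapreste_indexP (p q : \bar R) :
  (1 <= p -> 1 <= q -> 1 <= p^-1 + q^-1 ->
  1 <= lapreste_index p q /\
  (lapreste_index p q)^-1 + (q^*)^-1 + (p^*)^-1 = 1)%E.
Proof.
have conjV (s : \bar R) : (1 <= s -> exists2 t : R, (t <= 1)%R &
    (s^*)^-1 = (1 - t)%:E /\ s^-1 = t%:E)%E.
  case: s => [s||]; last by [].
  - rewrite lee_fin => s1.
    have s0 : s != 0 by rewrite gt_eqF// (lt_le_trans ltr01).
    exists s^-1; first by rewrite invf_le1// (lt_le_trans ltr01).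
    split; last by rewrite inver (negbTE s0).
    have := @hoelder_conjugate_eq1 R s%:E (ltNyr _).
    rewrite eqe => /(_ s0); rewrite inver (negbTE s0).
    case: ((s%:E^*)^-1)%E => [z||]// /eqP; rewrite -EFinD eqe => /eqP <-.
    by rewrite addrC addKr.
  - by move=> _; exists 0; rewrite // invey hoelder_conjugatey inve1 subr0.
rewrite /lapreste_index inveK.
move=> /conjV[t t1 [-> ->]] /conjV[u u1 [-> ->]].
rewrite -!EFinD lee_fin => tu; split; last by congr EFin; lra.
rewrite inver; case: ifPn => [_|w0]; first exact: leey.
rewrite lee_fin invf_ge1; first lra.
by rewrite lt_neqAle eq_sym w0/=; lra.
Qed.

Definition lapreste_norm (p q : \bar R) (u : tensorY) : \bar R := ereal_inf
  [set t | exists (m : nat) (lam : 'I_m -> K) (a b : 'I_m -> mtensor X)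
             (y : 'I_m -> Y),
     [/\ forall i, decomposable (a i),
         forall i, decomposable (b i),
         u = \sum_(i < m) lam i *: tensY (a i - b i) (y i) &
         t = ((lnorm (lapreste_index p q) lam)%:E
              * weak_lnorm_tensor q^* a b * weak_lnorm p^* y)%E]].

Definition lapreste_bounded (p q : \bar R) (zeta : {scalar tensorY}) : Prop :=
  exists C : R, forall u,
    ((nrm (zeta u : K))%:E <= C%:E * lapreste_norm p q u)%E.

Definition lapreste_dual_norm (p q : \bar R) (zeta : {scalar tensorY}) :
  \bar R := ereal_sup
    [set (nrm (zeta u : K))%:E | u in [set u | (lapreste_norm p q u <= 1)%E]].

Definition wstar_mdual : topologicalType := wstar (cpair X).
Definition wstar_dual : topologicalType := wstar (bdual_pair Y).

(* The exponents [q^*] and [p^*] of the integrals are finite in the branches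
   where they are used. *)
Definition lapreste_dominated (p q : \bar R) (zeta : {scalar tensorY})
    (A : set wstar_mdual) (A0 : A !=set0)
    (B : set wstar_dual) (B0 : B !=set0) (C : R)
    (mu : probability (borel_of (subspace_of A0)) R)
    (nu : probability (borel_of (subspace_of B0)) R) : Prop :=
  forall (a b : mtensor X) (y : Y), decomposable a -> decomposable b ->
    ((nrm (zeta (tensY (a - b) y) : K))%:E <=
      C%:E
      * (if q == 1 then proj_norm (a - b) else
           'N[mu]_(q^*)[(fun psi =>
              (nrm (mpair (\val psi) a - mpair (\val psi) b))%:E)])
      * (if p == 1 then (nrm y)%:E else
           'N[nu]_(p^*)[(fun f => (nrm (bdual_pair Y (\val f) y))%:E)]))%E.

Definition domination_constant (p q : \bar R) (zeta : {scalar tensorY})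
    (A : set wstar_mdual) (A0 : A !=set0)
    (B : set wstar_dual) (B0 : B !=set0) : set R :=
  [set C | 0 <= C /\
     exists (mu : probability (borel_of (subspace_of A0)) R)
            (nu : probability (borel_of (subspace_of B0)) R),
       [/\ regular_measure mu, regular_measure nu & lapreste_dominated p q zeta C mu nu]].

End Laprest.

(* Main.v *)
Require Import Defs.
From HB Require Import structures.
From mathcomp Require Import all_boot all_order all_algebra.
From mathcomp Require Import complex ring lra.
From mathcomp Require Import all_classical all_reals all_analysis.
From mathcomp Require Import measurable_realfun.

Set Implicit Arguments.
Unset Strict Implicit.
Unset Printing Implicit Defensive.

Import Order.TTheory GRing.Theory Num.Theory.
Import numFieldNormedType.Exports.

Local Open Scope classical_set_scope.
Local Open Scope ring_scope.

(* A representation bound [|zeta u| <= C |lam|_r |a - b|_s |y|_t], with [s = q^*]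
   and [t = p^*], becomes after weighted AM-GM the statement that every convex
   combination of the functions
     [C (1/r + |psi(a - b)|^s / s + |f(y)|^t / t) - |zeta((a - b) (x) y)|]
   on [K * L] has nonnegative supremum; an infinite exponent contributes no
   term, but then [a - b] (or [y]) is restricted to the unit ball.  The
   Mazur-Orlicz form of the Hahn-Banach theorem gives a mean on bounded functions
   that is nonnegative on all of them.  Its marginals, dominated by regular Borel
   probability measures, satisfy the additive inequality, and normalising both
   arguments turns it into the product inequality with the same constant.
   The weak norms, suprema over whole dual balls, can be computed on the norming
   sets by l^s-duality.  Conversely, integrating against the measures and
   applying Hoelder's inequality with three exponents gives the representation
   bound; it is applied to the dual balls, which are weak* compact
   (Banach-Alaoglu) and norming (Hahn-Banach). *)

(** * Hahn-Banach theorem, Mazur-Orlicz form *)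

(** The mean lives on all bounded functions over [K * L], so it has a value on every indicator, and
    a regular measure is rebuilt from these values on closed sets without a Riesz representation. It
    only has to dominate the mean on nonnegative continuous functions, because both integrals stand
    on the larger side of the inequality with nonnegative coefficients. Each test function is a
    function of [psi] plus a function of [f]; hence near-maximal points can be chosen independently,
    and two marginals replace a measure on the product.

    A weight [w] of a convex combination is distributed over a representation as [w^(1/r)],
    [w^(1/s)] and [w^(1/t)], whose product is [w] since the reciprocals sum to 1. With [1/oo = 0]
    and zero to the power zero equal to one, most of the argument treats finite and infinite
    exponents alike. Phases of modulus one, absorbed in the [lam i], prevent cancellation over
    either field. *)

Section MazurOrlicz.
Variables (R : realType) (V : lmodType R).
Implicit Types (p q : V -> R) (Q : set (V * R)).

Definition sublinear p :=
  (forall x y, p (x + y) <= p x + p y) /\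
  (forall t x, 0 <= t -> p (t *: x) = t * p x).

Lemma sublinear0 p : sublinear p -> p 0 = 0.
Proof. by move=> [_ pZ]; rewrite -(scale0r 0) pZ// mul0r. Qed.

Lemma sublinear_ge p x y : sublinear p -> p y - p (- x) <= p (x + y).
Proof.
by move=> [pD _]; rewrite lerBlDr; apply: le_trans (pD _ _); rewrite addrAC subrr add0r.
Qed.

(** A pair [(x, c)] in [Q] stands for the requirement [c <= f x] on a functional [f] still to be
    found. Sums and nonnegative multiples of requirements are again requirements. *)
Definition dominated_cone p Q :=
  [/\ Q (0, 0),
      forall u v, Q u -> Q v -> Q (u.1 + v.1, u.2 + v.2),
      forall t u, 0 <= t -> Q u -> Q (t *: u.1, t * u.2) &
      forall u, Q u -> u.2 <= p u.1].

(** The witness [q x] is the infimum of [p (x + u.1) - u.2] over [Q]. A linear functional below [q]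
    satisfies all requirements in [Q], so they are absorbed into the majorant. The infimum is finite
    by [lbS], which is where [Q] being dominated by [p] enters. *)
Lemma sublinear_inf p Q : sublinear p -> dominated_cone p Q ->
  exists q, [/\ sublinear q, forall x, q x <= p x &
    forall u, Q u -> q (- u.1) <= - u.2].
Proof.
move=> ps [Q0 QD QZ Qp]; have [pD pZ] := ps.
pose S x := [set p (x + u.1) - u.2 | u in Q].
have lbS x : lbound (S x) (- p (- x)).
  move=> _ [u Qu <-]; rewrite lerBrDr addrC.
  by apply: le_trans (sublinear_ge x u.1 ps); rewrite lerD2r Qp.
have hlS x : has_lbound (S x) by exists (- p (- x)); exact: lbS.
have infS x u : Q u -> inf (S x) <= p (x + u.1) - u.2.
  by move=> Qu; apply: ge_inf => //; exists u.
have le_inf_of x c : (forall u, Q u -> c <= p (x + u.1) - u.2) -> c <= inf (S x).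
  move=> cS; apply: lb_le_inf; first by exists (p (x + 0) - 0); exists (0, 0).
  by move=> _ [u Qu <-]; exact: cS.
exists (fun x => inf (S x)); split; last 2 first.
- by move=> x; rewrite (le_trans (infS x _ Q0))//= addr0 subr0.
- by move=> u Qu; rewrite (le_trans (infS _ _ Qu))// addNr sublinear0// sub0r.
split.
  move=> x y; rewrite -lerBlDr; apply: (le_inf_of) => u Qu.
  rewrite lerBlDr -lerBlDl; apply: (le_inf_of) => v Qv.
  rewrite lerBlDl (le_trans (infS _ _ (QD _ _ Qu Qv)))//=.
  have := pD (x + u.1) (y + v.1); rewrite addrACA; lra.
have hom t x : 0 < t -> inf (S (t *: x)) <= t * inf (S x).
  move=> t0; rewrite mulrC -ler_pdivrMr//; apply: (le_inf_of) => u Qu.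
  rewrite ler_pdivrMr// (le_trans (infS _ _ (QZ _ _ (ltW t0) Qu)))//=.
  by rewrite -scalerDr (pZ _ _ (ltW t0)); lra.
move=> t x; rewrite (le_eqVlt 0) => /predU1P[<-|t0].
  rewrite scale0r mul0r; apply/eqP; rewrite eq_le; apply/andP; split.
    by rewrite (le_trans (infS _ _ Q0))//= addr0 subr0 sublinear0.
  by apply: (le_inf_of) => u Qu; rewrite add0r subr_ge0 Qp.
apply/eqP; rewrite eq_le hom//= -ler_pdivlMl//.
have := hom t^-1 (t *: x); rewrite scalerA mulVf ?gt_eqF// scale1r.
by apply; rewrite invr_gt0.
Qed.

(** Zorn's lemma for the order in which larger means pointwise smaller. A nonempty chain is bounded
    by its pointwise infimum, finite because every member is at least [- p (- x)] at [x]. *)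
Lemma minimal_sublinear p : sublinear p -> exists q,
  [/\ sublinear q, forall x, q x <= p x &
      forall r, sublinear r -> (forall x, r x <= q x) -> r = q].
Proof.
move=> ps; pose T := {q | sublinear q /\ forall x, q x <= p x}.
pose le (q r : T) := `[< forall x, sval r x <= sval q x >].
have lb (q : T) x : - p (- x) <= sval q x.
  have [qs qp] := svalP q; have [qD _] := qs.
  rewrite lerNl; apply: le_trans (qp _).
  by rewrite -subr_ge0 opprK addrC -(sublinear0 qs) -(subrr x) qD.
have [||||q qmin] := @Zorn T le.
- by move=> q; apply/asboolP.
- move=> q r s /asboolP qr /asboolP rs; apply/asboolP => x.
  exact: le_trans (rs x) (qr x).
- move=> [q Pq] [r Pr] /asboolP/= qr /asboolP/= rq.
  have E : q = r by apply/funext => x; apply/eqP; rewrite eq_le qr rq.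
  by case: _ / E Pr {qr rq} => Pr; congr exist; exact: Prop_irrelevance.
- move=> A Atot; have [[q0 Aq0]|A0] := pselect (A !=set0); last first.
    exists (exist _ p (conj ps (fun x => lexx _))) => s As.
    by exfalso; apply: A0; exists s.
  pose S x := [set sval q x | q in A].
  have hlS x : has_lbound (S x) by exists (- p (- x)) => _ [q _ <-]; exact: lb.
  have infS x (r : T) : A r -> inf (S x) <= sval r x.
    by move=> Ar; apply: ge_inf => //; exists r.
  have le_inf_of x c : (forall r : T, A r -> c <= sval r x) -> c <= inf (S x).
    move=> cS; apply: lb_le_inf; first by exists (sval q0 x); exists q0.
    by move=> _ [u Qu <-]; exact: cS.
  have Ss : sublinear (fun x => inf (S x)).
    split=> [x y|t x].
      rewrite -lerBlDr; apply: (le_inf_of) => q Aq.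
      rewrite lerBlDr -lerBlDl; apply: (le_inf_of) => r Ar; rewrite lerBlDl.
      (* In a chain the smaller of [q] and [r] can serve both arguments, so subadditivity survives
         the infimum. *)
      have [/asboolP qr|/asboolP rq] := Atot _ _ Aq Ar.
        have [[rD _] _] := svalP r.
        by rewrite (le_trans (infS _ _ Ar))// (le_trans (rD _ _))// lerD2r qr.
      have [[qD _] _] := svalP q.
      by rewrite (le_trans (infS _ _ Aq))// (le_trans (qD _ _))// lerD2l rq.
    rewrite (le_eqVlt 0) => /predU1P[<-|t0].
      rewrite scale0r mul0r; apply/eqP; rewrite eq_le; apply/andP; split.
        by rewrite (le_trans (infS _ _ Aq0))// sublinear0//; have [] := svalP q0.
      by apply: (le_inf_of) => q _; rewrite sublinear0//; have [] := svalP q.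
    apply/eqP; rewrite eq_le; apply/andP; split.
      rewrite mulrC -ler_pdivrMr//; apply: (le_inf_of) => q Aq.
      have [[_ qZ] _] := svalP q.
      by rewrite ler_pdivrMr// mulrC -(qZ _ _ (ltW t0)) infS.
    apply: (le_inf_of) => q Aq; have [[_ qZ] _] := svalP q.
    by rewrite (qZ _ _ (ltW t0)) ler_pM2l// infS.
  have Sp x : inf (S x) <= p x.
    by rewrite (le_trans (infS _ _ Aq0))//; have [_] := svalP q0.
  exists (exist _ (fun x => inf (S x)) (conj Ss Sp)) => s As.
  by apply/asboolP => x /=; exact: infS.
- have [qs qp] := svalP q; exists (sval q); split=> // r rs rq.
  have rp x : r x <= p x by exact: le_trans (rq x) (qp x).
  by have /(congr1 sval) := qmin (exist _ r (conj rs rp)) (asboolT rq).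
Qed.

(* A minimal sublinear functional is linear: lowering it along a ray, as in
   [sublinear_inf], must not change it. *)
Theorem mazur_orlicz p Q : sublinear p -> dominated_cone p Q ->
  exists f : {scalar V}, (forall x, f x <= p x) /\ forall u, Q u -> u.2 <= f u.1.
Proof.
move=> ps pQ; have [q [qs qp qQ]] := sublinear_inf ps pQ.
have [f [fs fq fmin]] := minimal_sublinear qs; have [fD fZ] := fs.
have fadd x y : f (x + y) = f x + f y.
  apply/eqP; rewrite eq_le fD/=.
  pose Q' := [set (t *: y, t * f y) | t in [set t | 0 <= t]].
  have [||g [gs gf gQ]] := @sublinear_inf f Q' => //.
    split.
    - by exists 0 => //=; rewrite scale0r mul0r.
    - move=> _ _ [s s0 <-] [t t0 <-]; exists (s + t) => /=; first exact: addr_ge0.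
      by rewrite scalerDl mulrDl.
    - move=> t _ t0 [s s0 <-]; exists (t * s) => /=; first exact: mulr_ge0.
      by rewrite scalerA mulrA.
    - by move=> _ [t t0 <-] /=; rewrite fZ.
  have E := fmin g gs gf; subst g.
  have := gQ (1 *: y, 1 * f y) (ex_intro2 _ _ 1 ler01 erefl).
  rewrite /= scale1r mul1r => fN.
  have := fD (x + y) (- y); rewrite addrK; lra.
have fN x : f (- x) = - f x.
  by apply/eqP; rewrite -addr_eq0 addrC -fadd subrr sublinear0.
have fscal : scalar f.
  move=> t x y; rewrite fadd; congr (_ + _) => /=.
  have [t0|/ltW t0] := leP 0 t; first exact: fZ.
  rewrite -[t]opprK scaleNr fN fZ ?oppr_ge0//.
  by rewrite !mulNr.
pose F : {scalar V} := HB.pack (f : V -> R^o)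
  (GRing.isLinear.Build R V R^o *%R f fscal).
exists F; split=> [x|u Qu] /=; first exact: le_trans (fq x) (qp x).
by rewrite -lerN2 -fN (le_trans (fq _))// qQ.
Qed.

End MazurOrlicz.

(** * Regular Borel measures from finitely additive ones *)

(** Additivity is asked on all subsets: a functional on all bounded functions assigns a value to
    every indicator, measurable or not. *)
Record finitely_additive_prob (R : realType) (T : Type) (m : set T -> R) :
    Prop := FinitelyAdditiveProb {
  fap_ge0 : forall E, 0 <= m E;
  fap_setT : m setT = 1;
  fapU : forall E F, E `&` F = set0 -> m (E `|` F) = m E + m F }.

(* The closed sets carry the finitely additive [m]; the regular measure is the
   outer measure generated by the inner approximation of open sets by closed
   sets, so that [m F <= mu F] for closed [F], which is all that is needed. *)
Section InnerContent.
Variables (R : realType) (T : ptopologicalType) (m : set T -> R).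
Hypotheses (fm : finitely_additive_prob m) (cptT : compact [set: T])
  (hausT : hausdorff_space T).

Lemma fap_set0 : m set0 = 0.
Proof.
have := fapU fm (setI0 (set0 : set T)); rewrite setU0 => /eqP.
by rewrite -subr_eq0 opprD addNKr oppr_eq0 => /eqP.
Qed.

Lemma le_fap E F : E `<=` F -> m E <= m F.
Proof.
move=> EF; rewrite -(setDUK EF) (fapU fm) ?setDIK//.
by rewrite lerDl fap_ge0.
Qed.

Lemma fapU_le E F : m (E `|` F) <= m E + m F.
Proof.
have -> : E `|` F = E `|` F `\` E.
  by apply/seteqP; split=> x; have [|] := pselect (E x); rewrite /=; tauto.
by rewrite (fapU fm) ?setDIK// lerD2l le_fap.
Qed.

Definition open_content (U : set T) : R :=
  sup [set m F | F in [set F | closed F /\ F `<=` U]].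

Local Notation gamma := open_content.

Lemma open_content_ub U F : closed F -> F `<=` U -> m F <= gamma U.
Proof.
move=> cF FU; apply: ub_le_sup; last by exists F.
by exists 1 => _ [G _ <-]; rewrite -(fap_setT fm) le_fap.
Qed.

Lemma open_content_le U c : (forall F, closed F -> F `<=` U -> m F <= c) ->
  gamma U <= c.
Proof.
move=> Uc; apply: ge_sup; last by move=> _ [F [cF FU] <-]; exact: Uc.
by exists (m set0), set0; split => //; exact: closed0.
Qed.

Lemma open_content_ge0 U : 0 <= gamma U.
Proof. by rewrite -fap_set0 open_content_ub//; exact: closed0. Qed.

Lemma le_open_content U V : U `<=` V -> gamma U <= gamma V.
Proof.
move=> UV; apply: open_content_le => F cF FU.
exact: open_content_ub (subset_trans FU UV).
Qed.

Lemma open_content_set0 : gamma set0 = 0.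
Proof.
apply/eqP; rewrite eq_le open_content_ge0 andbT; apply: open_content_le => F _.
by rewrite subset0 => ->; rewrite fap_set0.
Qed.

Lemma open_content_setT : gamma setT = 1.
Proof.
apply/eqP; rewrite eq_le; apply/andP; split.
  by apply: open_content_le => F _ _; rewrite -(fap_setT fm) le_fap.
by rewrite -(fap_setT fm) open_content_ub//; exact: closedT.
Qed.

(** Normality splits a closed [F] inside the union into closed pieces: the part in [closure N] lies
    in [U], and the part outside the open [W] lies in [V]. *)
Lemma open_contentU U V : open U -> open V ->
  gamma (U `|` V) <= gamma U + gamma V.
Proof.
move=> oU oV; apply: open_content_le => F cF FUV.
have FVU : F `\` V `<=` U by move=> x [/FUV[]].
have cFV : closed (F `\` V) by rewrite setDE; apply: closedI => //; exact: open_closedC.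
have FVU' : set_nbhs (F `\` V) U.
  by apply/set_nbhsP; exists U; split.
have [N nN NU] := compact_normal hausT cptT cFV FVU'.
move: nN => /set_nbhsP[W [oW FVW WN]].
have -> : F = (F `&` closure N) `|` (F `\` W).
  apply/seteqP; split=> [x Fx|x [[]|[]]//].
  have [Wx|nWx] := pselect (W x); [left|right] => //; split=> //.
  exact/subset_closure/WN.
apply: le_trans (fapU_le _ _) _; apply: lerD; apply: open_content_ub.
- by apply: closedI => //; exact: closed_closure.
- by move=> x [_ /NU].
- by rewrite setDE; apply: closedI => //; exact: open_closedC.
- by move=> x [Fx nWx]; apply: contrapT => nVx; apply: nWx; exact: FVW.
Qed.

(** Compactness is the source of countable subadditivity: a closed subset of the union is covered by
    finitely many [U i], for which [open_contentU] suffices. *)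
Lemma open_content_bigcup_le (U : (set T)^nat) (c : nat -> R) (x : R) :
  (forall i, open (U i)) -> (forall i, gamma (U i) <= c i) ->
  (forall n, \sum_(i < n) c i <= x) -> gamma (\bigcup_i U i) <= x.
Proof.
move=> oU Uc cx; apply: open_content_le => F cF FU.
have Ufin n : gamma (\big[setU/set0]_(i < n) U i) <= \sum_(i < n) c i.
  elim: n => [|n IH]; first by rewrite !big_ord0 open_content_set0.
  rewrite !big_ord_recr/=; apply: le_trans (open_contentU _ (oU n)) _.
    by apply: big_ind => //; [exact: open0|exact: openU].
  exact: lerD.
have : cover_compact F.
  by rewrite -compact_cover; exact: (subclosed_compact cF cptT).
move=> /(_ nat setT U (fun i _ => oU i) FU) [D _ FD].
pose N := (\max_(i <- finmap.enum_fset D) i.+1)%N.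
apply: (@le_trans _ _ (gamma (\big[setU/set0]_(i < N) U i))); last first.
  exact: le_trans (Ufin _) (cx _).
apply: open_content_ub => // y /FD [i iD Uiy].
rewrite -bigcup_mkord; exists i => //=.
by rewrite /N (big_rem i)//= leq_max leqnn.
Qed.

Definition content_ext (E : set T) : \bar R :=
  (inf [set gamma U | U in [set U | open U /\ E `<=` U]])%:E.

Local Notation mu := content_ext.

Lemma content_ext_lb E U : open U -> E `<=` U -> (mu E <= (gamma U)%:E)%E.
Proof.
move=> oU EU; rewrite lee_fin; apply: ge_inf; last by exists U.
by exists 0 => _ [V _ <-]; exact: open_content_ge0.
Qed.

Lemma content_ext_glb E (c : R) :
  (forall U, open U -> E `<=` U -> c <= gamma U) -> (c%:E <= mu E)%E.
Proof.
move=> cE; rewrite lee_fin; apply: lb_le_inf.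
  by exists (gamma setT), setT; split => //; exact: openT.
by move=> _ [U [oU EU] <-]; exact: cE.
Qed.

Lemma content_ext_open U : open U -> mu U = (gamma U)%:E.
Proof.
move=> oU; apply/eqP; rewrite eq_le content_ext_lb//=.
by apply: content_ext_glb => V _; exact: le_open_content.
Qed.

Lemma content_ext_adherent E (e : R) : 0 < e ->
  exists U, [/\ open U, E `<=` U & gamma U <= fine (mu E) + e].
Proof.
move=> e0.
have [|_ [U [oU EU] <-] Ue] :=
    @inf_adherent _ [set gamma U | U in [set U | open U /\ E `<=` U]] e e0.
  split; first by exists (gamma setT), setT; split => //; exact: openT.
  by exists 0 => _ [V _ <-]; exact: open_content_ge0.
by exists U; split => //; exact: ltW.
Qed.

Lemma content_ext0 : mu set0 = 0%E.
Proof. by rewrite content_ext_open ?open_content_set0//; exact: open0. Qed.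

Lemma content_ext_ge0 E : (0 <= mu E)%E.
Proof. by apply: content_ext_glb => U _ _; exact: open_content_ge0. Qed.

Lemma le_content_ext : {homo mu : E F / E `<=` F >-> (E <= F)%E}.
Proof.
move=> E F EF; apply: content_ext_glb => U oU FU.
by rewrite -lee_fin content_ext_lb//; exact: subset_trans FU.
Qed.

Lemma content_ext_sigma_subadditive : sigma_subadditive mu.
Proof.
move=> E; apply/lee_addgt0Pr => e e0.
have d0 n : 0 < e / (2 ^ n.+1)%:R by rewrite divr_gt0// ltr0n expn_gt0.
have [U HU] := choice (fun n => content_ext_adherent (E n) (d0 n)).
have oU i : open (U i) by have [] := HU i.
apply: le_trans _ (epsilon_trick xpredT (fun n => content_ext_ge0 (E n)) (ltW e0)).
apply: (@le_trans _ _ (gamma (\bigcup_i U i))%:E).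
  apply: content_ext_lb; first exact: bigcup_open.
  by move=> x [i _ Eix]; exists i => //; have [_ sub _] := HU i; exact: sub.
have term_ge0 n : (0 <= mu (E n) + (e / (2 ^ n.+1)%:R)%:E)%E.
  by rewrite adde_ge0 ?content_ext_ge0// lee_fin ltW.
set s := (X in (_ <= X)%E).
have sn n : ((\sum_(i < n) (fine (mu (E i)) + e / (2 ^ i.+1)%:R))%:E <= s)%E.
  rewrite /s -sumEFin -(big_mkord xpredT (fun i => (fine (mu (E i)) + e / (2 ^ i.+1)%:R)%:E)).
  apply: (@nneseries_lim_ge _ (fun i => mu (E i) + (e / (2 ^ i.+1)%:R)%:E)%E
    xpredT 0%N n) => i _ _.
  exact: term_ge0.
case: s sn => [s| |] sn; last 2 first.
- by rewrite leey.
- by have := sn 0%N; rewrite leeNy_eq.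
rewrite lee_fin; apply: (open_content_bigcup_le oU) => [i|n].
  by have [_ _] := HU i; exact.
by have := sn n; rewrite lee_fin.
Qed.

HB.instance Definition _ := isOuterMeasure.Build R T mu content_ext0
  content_ext_ge0 le_content_ext content_ext_sigma_subadditive.

(** Let the open [U] contain [E]. A closed [F] in the part of [U] inside [V] is fixed first; what
    remains of [U] is open and contains the part of [E] outside [V]. A closed [G] in this remainder
    is disjoint from [F], so additivity of [m] bounds [m F + m G] by the content of [U]. *)
Lemma open_caratheodory V : open V -> mu.-caratheodory V.
Proof.
move=> oV; apply: le_caratheodory_measurable => E.
rewrite -EFinD; apply: content_ext_glb => U oU EU; rewrite -lerBrDr.
have EV : E `&` V `<=` U `&` V by move=> x [/EU].
have oUV : open (U `&` V) by exact: openI.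
rewrite -lee_fin; apply: le_trans (content_ext_lb oUV EV) _.
rewrite lee_fin; apply: open_content_le => F cF FUV.
rewrite lerBrDr -lerBrDl.
have oUF : open (U `\` F) by rewrite setDE; apply: openI => //; exact: closed_openC.
have EUF : E `&` ~` V `<=` U `\` F.
  by move=> x [/EU Ux nVx]; split => // /FUV[].
rewrite -lee_fin; apply: le_trans (content_ext_lb oUF EUF) _.
rewrite lee_fin; apply: open_content_le => G cG GUF.
rewrite lerBrDl -(fapU fm); last first.
  by apply/seteqP; split => // x [Fx /GUF[]].
apply: open_content_ub; first exact: closedU.
by move=> x [/FUV[]|/GUF[]].
Qed.

Lemma borel_caratheodory (E : set (borel_of T)) :
  measurable E -> mu.-cara.-measurable E.
Proof.
move: E; apply: smallest_sub.
  split => //; [by move=> X mX; rewrite setTD; exact: measurableC |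
                by move=> u_ mu_; exact: bigcupT_measurable].
by move=> V oV; exact: open_caratheodory.
Qed.

Definition content_measure (E : set (borel_of T)) : \bar R := mu E.

Let content_measure_sigma_additive : semi_sigma_additive content_measure.
Proof.
move=> F mF tF mUF; apply: caratheodory_measure_sigma_additive => //.
- by move=> i; exact: borel_caratheodory.
- exact: borel_caratheodory.
Qed.

HB.instance Definition _ := isMeasure.Build _ _ _ content_measure
  content_ext0 content_ext_ge0 content_measure_sigma_additive.

Let content_measure_setT : content_measure setT = 1%E.
Proof. by have := content_ext_open (@openT T); rewrite open_content_setT. Qed.

HB.instance Definition _ :=
  Measure_isProbability.Build _ _ _ content_measure content_measure_setT.

Lemma borel_open (U : set T) : open U -> measurable (U : set (borel_of T)).
Proof. by move=> oU; exact: sub_sigma_algebra. Qed.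

Lemma borel_closed (F : set T) : closed F -> measurable (F : set (borel_of T)).
Proof.
move=> cF; have := measurableC (borel_open (closed_openC cF)).
by rewrite setCK.
Qed.

Theorem regular_extension : exists mu : probability (borel_of T) R,
  regular_measure mu /\ forall F : set T, closed F -> ((m F)%:E <= mu F)%E.
Proof.
exists content_measure; split; last first.
  by move=> F cF; apply: content_ext_glb => U _; exact: open_content_ub.
have outer E : content_measure E =
    ereal_inf [set content_measure U | U in [set U : set T | open U /\ E `<=` U]].
  apply/eqP; rewrite eq_le; apply/andP; split.
    by apply: le_ereal_inf_tmp => _ [U [_ EU] <-]; exact: le_content_ext.
  apply/lee_addgt0Pr => e e0; have [U [oU EU Ue]] := content_ext_adherent E e0.
  apply: (@le_trans _ _ (gamma U)%:E); last by rewrite -lee_fin EFinD in Ue.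
  by apply: ereal_inf_lbound; exists U => //; exact: content_ext_open.
move=> E mE; split; first exact: outer.
apply/eqP; rewrite eq_le; apply/andP; split; last first.
  by apply: ge_ereal_sup => _ [F [_ FE] <-]; exact: le_content_ext.
apply/lee_addgt0Pr => e e0.
(* Inner regularity is outer regularity of the complement: the complement of an open [U] that
   approximates the complement of [E] is closed, hence compact. *)
have [U [oU EU Ue]] := content_ext_adherent (~` E) e0.
have cU : closed (~` U) by exact: open_closedC.
have UE : ~` U `<=` E by rewrite -(setCK E); exact: subsetC.
apply: (@le_trans _ _ (content_measure (~` U) + e%:E)%E); last first.
  rewrite leeD2r//; apply: ereal_sup_ubound; exists (~` U) => //; split => //.
  exact: subclosed_compact cptT _.
have Ec : content_measure E = (1 - content_measure (~` E))%E.
  rewrite -[in LHS](setCK E).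
  exact: (@probability_setC _ _ _ content_measure _ (measurableC mE)).
have Uc : content_measure (~` U) = (1 - content_measure U)%E.
  exact: (@probability_setC _ _ _ content_measure _ (borel_open oU)).
suff : (content_measure E <= content_measure (~` U) + e%:E)%E by [].
rewrite Ec Uc /content_measure (content_ext_open oU) /content_ext.
by rewrite -!EFinB -EFinD lee_fin; move: Ue; rewrite /content_ext/=; lra.
Qed.

End InnerContent.

(** * Means on bounded functions *)

Section BoundedFunctions.
Variables (R : realType) (S : Type).

Definition bounded_fun : {pred S -> R^o} :=
  fun f => `[< exists M : R, forall s, `|f s : R| <= M >].

Lemma bounded_fun_closed : submod_closed bounded_fun.
Proof.
split; first by apply/asboolP; exists 0 => s /=; rewrite normr0.
move=> a u v /asboolP[M uM] /asboolP[N vN]; apply/asboolP.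
exists (`|a| * M + N) => s.
rewrite (le_trans (ler_normD _ _))// lerD// normrM ler_wpM2l//; exact: uM.
Qed.

HB.instance Definition _ := GRing.isSubmodClosed.Build R
  (S -> R^o) bounded_fun bounded_fun_closed.

Record bfun : Type := BFun {
  bfun_val :> S -> R^o;
  bfun_valP : bfun_val \in bounded_fun }.

HB.instance Definition _ := [isSub for bfun_val].
HB.instance Definition _ := [Choice of bfun by <:].
HB.instance Definition _ := [SubChoice_isSubLmodule of bfun by <:].

Definition mk_bfun (f : S -> R) (M : R) (fM : forall s, `|f s| <= M) : bfun :=
  BFun (asboolT (ex_intro _ M fM) : (f : S -> R^o) \in bounded_fun).

Lemma bfun_bounded (f : bfun) : exists M : R, forall s, `|f s : R| <= M.
Proof. by have /asboolP := bfun_valP f. Qed.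

(** Positivity and normalisation in a single condition: applied to [g] and [- g], it gives both. *)
Definition mean (L : {scalar bfun}) : Prop :=
  forall (g : bfun) (M : R), (forall s, (g s : R) <= M) -> (L g : R) <= M.

(** With [p] the supremum of a function, lying below [p] is the same as being a mean, and the last
    hypothesis says that [p] is nonnegative on [Q]. Each [g] in [Q] therefore enters the
    Mazur-Orlicz theorem as the requirement [(g, 0)]. *)
Theorem mean_on_cone (s0 : S) (Q : set bfun) :
  Q 0 -> (forall g h, Q g -> Q h -> Q (g + h)) ->
  (forall (t : R) g, 0 <= t -> Q g -> Q (t *: g)) ->
  (forall g, Q g -> forall e : R, 0 < e -> exists s, - e <= (g s : R)) ->
  exists L : {scalar bfun}, mean L /\ forall g, Q g -> 0 <= (L g : R).
Proof.
move=> Q0 QD QZ Qe; pose p (g : bfun) : R := sup (range (g : S -> R)).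
have p_ub (g : bfun) s : (g s : R) <= p g.
  have [M gM] := bfun_bounded g; apply: ub_le_sup; last by exists s.
  by exists M => _ [t _ <-]; rewrite (le_trans (ler_norm _)).
have p_le (g : bfun) c : (forall s, (g s : R) <= c) -> p g <= c.
  by move=> gc; apply: ge_sup; [exists (g s0), s0|move=> _ [s _ <-]].
have [||L [Lp LQ]] := @mazur_orlicz R bfun p [set (g, 0) | g in Q].
- split=> [g h|t g].
    by apply: p_le => s; apply: lerD; exact: p_ub.
  rewrite (le_eqVlt 0) => /predU1P[<-|t0].
    rewrite scale0r mul0r; apply/eqP; rewrite eq_le; apply/andP; split.
      exact: p_le.
    exact: (p_ub 0 s0).
  apply/eqP; rewrite eq_le; apply/andP; split.
    by apply: p_le => s; rewrite ler_pM2l//; exact: p_ub.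
  rewrite -ler_pdivlMl//; apply: p_le => s; rewrite ler_pdivlMl//.
  exact: (p_ub (t *: g)).
- split; first by exists 0.
  + by move=> _ _ [g Qg <-] [h Qh <-] /=; exists (g + h); [exact: QD|rewrite addr0].
  + by move=> t _ t0 [g Qg <-]; exists (t *: g); [exact: QZ|rewrite mulr0].
  + move=> _ [g Qg <-] /=; apply/ler_addgt0Pr => e e0.
    have [s gs] := Qe g Qg e e0.
    by have := p_ub g s; move: gs; lra.
exists L; split=> [g M gM|g Qg]; first by apply: le_trans (Lp g) _; exact: p_le.
by apply: (LQ (g, 0)); exists g.
Qed.

End BoundedFunctions.

(** * Approximation from below by closed superlevel sets *)

Section Staircase.
Variable R : realType.
Implicit Types (e c : R) (n : nat).

(** For positive [e] and nonnegative [c], the largest multiple of [e] below [c], capped at [n * e].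
    As a function of [c] it is a sum of indicators of closed superlevel sets, the sets on which a
    mean and its measure can be compared. *)
Definition staircase e n c := \sum_(j < n) e * (j.+1%:R * e <= c)%R%:R.

Lemma staircase_le e n c : 0 < e -> 0 <= c -> staircase e n c <= c.
Proof.
(* The second bound carries the induction: if level [n.+1] is counted, the sum grows by [e] to at
   most [n.+1 * e], which is below [c]. *)
move=> e0 c0; suff /andP[] : (staircase e n c <= c) && (staircase e n c <= n%:R * e) by [].
rewrite /staircase; elim: n => [|n /andP[IH1 IH2]]; first by rewrite big_ord0 c0 mul0r lexx.
rewrite big_ord_recr/=; have [nc|nc] := leP (n.+1%:R * e) c; last first.
  rewrite mulr0 addr0 IH1/=; apply: le_trans IH2 _.
  by rewrite ler_wpM2r ?(ltW e0)// ler_nat.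
move: nc; rewrite mulr1 -natr1 mulrDl mul1r => nc.
by rewrite lerD2r IH2 andbT (le_trans _ nc)// lerD2r.
Qed.

Lemma staircase_ge e n c : 0 < e -> c <= n%:R * e -> c <= staircase e n c + e.
Proof.
move=> e0; suff : (n%:R * e <= c -> n%:R * e <= staircase e n c) /\
                  (c <= n%:R * e -> c <= staircase e n c + e) by case.
rewrite /staircase; elim: n => [|n [IH1 IH2]].
  rewrite big_ord0 mul0r add0r; split=> // c0; exact: le_trans c0 (ltW e0).
rewrite big_ord_recr/= -natr1 mulrDl mul1r.
have [nc|nc] := leP (n%:R * e + e) c; rewrite ?mulr1 ?mulr0 ?addr0; last first.
  split=> // _.
  have [cn|/ltW cn] := leP c (n%:R * e); first exact: IH2.
  by rewrite (le_trans (ltW nc))// lerD2r IH1.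
have {}IH1 : n%:R * e <= \sum_(j < n) e * (j.+1%:R * e <= c)%R%:R by apply: IH1; lra.
by split=> H; lra.
Qed.

End Staircase.

(** * Domination of a mean by a regular measure *)

Section Representation.
Variables (R : realType) (T : ptopologicalType) (S : Type) (h : S -> T).
Variable L : {scalar bfun R S}.
Hypotheses (Lmean : mean L) (cptT : compact [set: T])
  (hausT : hausdorff_space T).

Lemma continuous_borel_measurable (f : T -> R) :
  continuous f -> measurable_fun setT (f : borel_of T -> R).
Proof.
move=> cf; apply: (measurability _ (RGenOInfty.measurableE R)).
move=> _ [_ [a ->] <-]; rewrite setTI; apply: borel_open.
by move/continuousP : cf; apply; exact: interval_open.
Qed.

Lemma mean_ge0 (g : bfun R S) : (forall s, 0 <= (g s : R)) -> 0 <= (L g : R).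
Proof.
move=> g0; rewrite -oppr_le0 -linearN; apply: Lmean => s /=.
by rewrite oppr_le0; exact: g0.
Qed.

Lemma mean_cst (g : bfun R S) (c : R) : (forall s, (g s : R) = c) -> (L g : R) = c.
Proof.
move=> gc; apply/eqP; rewrite eq_le; apply/andP; split.
  by apply: Lmean => s; rewrite gc.
rewrite -lerN2 -linearN; apply: Lmean => s /=.
by rewrite lerN2 gc.
Qed.

Definition indic_bfun (E : set T) : bfun R S :=
  @mk_bfun R S (fun s => \1_E (h s)) 1
    (fun s => ltac:(by rewrite /indic; case: (_ \in _); rewrite ?normr1 ?normr0)).

Lemma mean_finitely_additive :
  finitely_additive_prob (fun E => L (indic_bfun E) : R).
Proof.
split=> [E||E F EF].
- by apply: mean_ge0 => s /=.
- by apply: mean_cst => s /=; rewrite indicT.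
- rewrite -linearD; congr (L _); apply/val_inj/funext => s.
  have : (\1_(E `|` F) (h s) : R) = \1_E (h s) + \1_F (h s); last by [].
  rewrite !indicE in_setU; have [Es|nEs] := boolP (h s \in E); last by rewrite add0r.
  suff -> : (h s \in F) = false by rewrite addr0.
  apply/negP => Fs; have : (E `&` F) (h s) by split; exact: set_mem.
  by rewrite EF.
Qed.

(** A layer-cake argument: up to [e], the mean of [g] is the mean of a staircase built on the closed
    sets [E j]. Their measures are at least their means, and the integral of the staircase is at
    most that of [f]. Composing with [h] yields marginals when [h] is a projection. *)
Theorem mean_representation : exists mu : probability (borel_of T) R,
  regular_measure mu /\ forall (f : T -> R) (g : bfun R S), continuous f ->
    (forall x, 0 <= f x) -> (forall s, g s = f (h s)) ->
    ((L g : R)%:E <= \int[mu]_x (f x)%:E)%E.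
Proof.
have [mu [rmu muF]] := regular_extension mean_finitely_additive cptT hausT.
exists mu; split=> // f g cf f0 gf.
apply/lee_addgt0Pr => e e0.
have [M gM] := bfun_bounded g.
(* Enough steps of height [e] to pass the bound [M], so that the staircase is within [e] of [f] on
   the range of [h]. *)
pose n := (Num.truncn (M / e)).+1.
have Mn : M <= n%:R * e.
  by rewrite -ler_pdivrMr// ltW// /n truncnS_gt.
pose E j := f @^-1` [set y | (j.+1%:R * e <= y)].
have cE j : closed (E j).
  by apply: closed_comp => [x _|]; [exact: cf|exact: closed_ge].
have stairE s : staircase e n (f s) = \sum_(j < n) e * \1_(E j) s.
  apply: eq_bigr => j _; rewrite indicE; congr (_ * (nat_of_bool _)%:R).
  by apply/idP/idP => [?|/set_mem//]; apply/mem_set.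
pose G := \sum_(j < n) e *: indic_bfun (E j).
have GE s : (G s : R) = staircase e n (f (h s)).
  rewrite stairE /G; elim/big_rec2: _ => //= j _ x _ <-.
  by [].
have LG : (L g : R) <= L G + e.
  rewrite addrC -lerBlDr -linearB; apply: Lmean => s /=.
  have : (g s : R) <= staircase e n (f (h s)) + e.
    rewrite gf staircase_ge// (le_trans _ Mn)// -gf (le_trans _ (gM s))//.
    exact: ler_norm.
  rewrite -GE => gG; suff : (g s : R) - G s <= e by [].
  by rewrite lerBlDl.
apply: (@le_trans _ _ ((L G : R) + e)%:E); first by rewrite lee_fin.
rewrite EFinD leeD2r//.
apply: (@le_trans _ _ (\sum_(j < n) e%:E * mu (E j))%E).
  rewrite /G linear_sum -sumEFin; apply: lee_sum => j _.
  rewrite linearZ/= EFinM lee_pmul2l//; first exact: muF.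
have mE j : measurable (E j : set (borel_of T)) by exact: borel_closed.
have mI j : measurable_fun setT ((fun x => (e%:E * (\1_(E j) x)%:E)%E) : borel_of T -> \bar R).
  by apply: measurable_funeM; apply/measurable_EFinP; exact: measurable_indic.
rewrite (eq_bigr (fun j : 'I_n => (\int[mu]_x (e%:E * (\1_(E j) x)%:E))%E)); last first.
  move=> j _; rewrite ge0_integralZl//=; last 2 first.
  - by apply/measurable_EFinP; exact: measurable_indic.
  - by rewrite lee_fin ltW.
  by rewrite integral_indic// setIT.
rewrite -ge0_integral_sum//; last first.
  by move=> j x _; rewrite mule_ge0// lee_fin ltW.
apply: ge0_le_integral => //.
- by move=> x _; apply: sume_ge0 => j _; rewrite mule_ge0// lee_fin ltW.
- exact: emeasurable_sum.
- by apply/measurable_EFinP; exact: continuous_borel_measurable.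
move=> x _.
have -> : (\sum_(j < n) e%:E * (\1_(E j) x)%:E = (staircase e n (f x))%:E)%E.
  by rewrite stairE -sumEFin; apply: eq_bigr.
by rewrite lee_fin staircase_le.
Qed.

End Representation.

(** * Real and complex scalars *)

Lemma nrm_complexE (R : realType) (z : scalars R ComplexScalars) :
  nrm z = Num.sqrt ((complex.Re z) ^+ 2 + (complex.Im z) ^+ 2).
Proof. exact: (congr1 (@complex.Re R) (normc_def z)). Qed.

Section Scalars.
Variables (R : realType) (k : field_kind).
Local Notation K := (scalars R k).

Definition of_real : R -> K :=
  match k return R -> scalars R k with
  | RealScalars => fun x => x
  | ComplexScalars => fun x => (x%:C)%C
  end.

Definition scalars_im : K -> R :=
  match k return scalars R k -> R with
  | RealScalars => fun=> 0
  | ComplexScalars => fun z => complex.Im z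
  end.

Lemma of_realK : cancel of_real (@scalars_re R k).
Proof. by rewrite /of_real; case: k. Qed.

Lemma of_real0 : of_real 0 = 0. Proof. by rewrite /of_real; case: k. Qed.

Lemma of_real1 : of_real 1 = 1. Proof. by rewrite /of_real; case: k. Qed.

Lemma of_realD x y : of_real (x + y) = of_real x + of_real y.
Proof. by rewrite /of_real; case: k => //; rewrite rmorphD. Qed.

Lemma of_realN x : of_real (- x) = - of_real x.
Proof. by rewrite /of_real; case: k => //; rewrite rmorphN. Qed.

Lemma of_realM x y : of_real (x * y) = of_real x * of_real y.
Proof. by rewrite /of_real; case: k => //; rewrite rmorphM. Qed.

Lemma ler_of_real x y : (of_real x <= of_real y) = (x <= y).
Proof. by rewrite /of_real; case: k => //; rewrite lecR. Qed.

Lemma ltr_of_real x y : (of_real x < of_real y) = (x < y).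
Proof. by rewrite /of_real; case: k => //; rewrite ltcR. Qed.

Lemma of_real_ge0 (z : K) : 0 <= z -> of_real (scalars_re z) = z.
Proof.
by rewrite /of_real; case: k z => //= z z0; rewrite RRe_real// ger0_real.
Qed.

Section NormedZmod.
Variable V : normedZmodType K.
Implicit Types u v : V.

Lemma nrmE v : `|v| = of_real (nrm v).
Proof. by rewrite /nrm of_real_ge0. Qed.

Lemma nrm_ge0 v : 0 <= nrm v.
Proof. by rewrite -ler_of_real of_real0 -nrmE. Qed.

Lemma nrm0 : nrm (0 : V) = 0.
Proof. by rewrite /nrm normr0 -of_real0 of_realK. Qed.

Lemma nrm_eq0 v : (nrm v == 0) = (v == 0).
Proof.
rewrite -[v == 0]normr_eq0 nrmE; apply/eqP/eqP => [->|H]; first exact: of_real0.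
by rewrite -(of_realK (nrm v)) H -of_real0 of_realK.
Qed.

Lemma nrmD u v : nrm (u + v) <= nrm u + nrm v.
Proof. by rewrite -ler_of_real of_realD -!nrmE ler_normD. Qed.

Lemma nrmN v : nrm (- v) = nrm v.
Proof. by rewrite /nrm normrN. Qed.

Lemma nrm_distC u v : nrm (u - v) = nrm (v - u).
Proof. by rewrite -nrmN opprB. Qed.

Lemma nrm_dist u v : nrm u - nrm v <= nrm (u - v).
Proof. by rewrite lerBlDr (le_trans _ (nrmD _ _))// subrK. Qed.

Lemma nrm_dist_norm u v : `|nrm u - nrm v| <= nrm (u - v).
Proof. by rewrite ler_norml nrm_dist lerNl opprB nrm_distC nrm_dist. Qed.

Lemma nrm_sum (I : Type) (s : seq I) (f : I -> V) :
  nrm (\sum_(i <- s) f i) <= \sum_(i <- s) nrm (f i).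
Proof.
elim/big_ind2: _ => [|x1 x2 y1 y2 h1 h2|//]; first by rewrite nrm0.
by apply: le_trans (nrmD _ _) _; exact: lerD.
Qed.

End NormedZmod.

Lemma nrm_scalarM (x y : K) : nrm (x * y) = nrm x * nrm y.
Proof. by rewrite -[LHS]of_realK -nrmE normrM !nrmE -of_realM of_realK. Qed.

Lemma nrm_of_real t : nrm (of_real t) = `|t|.
Proof.
have [t0|/ltW t0] := leP 0 t.
  by rewrite /nrm !ger0_norm// ?of_realK// -of_real0 ler_of_real.
by rewrite /nrm !ler0_norm// -?of_realN ?of_realK// -of_real0 ler_of_real.
Qed.

Lemma nrm1 : nrm (1 : K) = 1.
Proof. by rewrite -of_real1 nrm_of_real normr1. Qed.

Lemma nrmZ (V : normedModType K) (c : K) (v : V) : nrm (c *: v) = nrm c * nrm v.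
Proof. by rewrite -[LHS]of_realK -nrmE normrZ !nrmE -of_realM of_realK. Qed.

Lemma re_le_nrm (z : K) : `|scalars_re z| <= nrm z.
Proof.
case: k z => z; first by [].
by rewrite nrm_complexE/= -sqrtr_sqr ler_wsqrtr// lerDl sqr_ge0.
Qed.

Lemma im_le_nrm (z : K) : `|scalars_im z| <= nrm z.
Proof.
rewrite /scalars_im; case: k z => z; first by rewrite normr0; exact: normr_ge0.
by rewrite nrm_complexE/= -sqrtr_sqr ler_wsqrtr// lerDr sqr_ge0.
Qed.

Lemma nrm_le_re_im (z : K) : nrm z <= `|scalars_re z| + `|scalars_im z|.
Proof.
rewrite /scalars_im; case: k z => z; first by rewrite normr0 addr0.
rewrite nrm_complexE/= -ler_sqr ?nnegrE ?sqrtr_ge0 ?addr_ge0//.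
rewrite sqr_sqrtr ?addr_ge0 ?sqr_ge0// sqrrD !real_normK ?num_real//.
by rewrite -addrA lerD2l addrC lerDl mulrn_wge0 ?mulr_ge0.
Qed.

Lemma unimodularP (z : K) : exists2 c : K, nrm c = 1 & c * z = of_real (nrm z).
Proof.
have [->|z0] := eqVneq z 0; first by exists 1; rewrite ?nrm1// mulr0 nrm0 of_real0.
exists (of_real (nrm z) / z); last by rewrite mulfVK.
have nz : nrm z != 0 by rewrite nrm_eq0.
have : nrm (of_real (nrm z) / z) * nrm z = nrm z.
  by rewrite -nrm_scalarM mulfVK// nrm_of_real ger0_norm// nrm_ge0.
by move=> /(canRL (mulfK nz)) ->; rewrite mulfV.
Qed.

Lemma cvg_nrmP (V : normedModType K) (T : Type) (F : set_system T)
    (FF : Filter F) (f : T -> V) (l : V) :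
  f @ F --> l <-> forall e : R, 0 < e -> \forall x \near F, nrm (l - f x) < e.
Proof.
split=> [/cvgrPdist_lt fl e e0|fl].
  have := fl (of_real e); rewrite -[X in X < _]of_real0 ltr_of_real => /(_ e0).
  by apply: filterS => x; rewrite nrmE ltr_of_real.
apply/cvgrPdist_lt => e e0.
have := fl (scalars_re e); rewrite -ltr_of_real of_real0 of_real_ge0 ?ltW// => /(_ e0).
by apply: filterS => x; rewrite -ltr_of_real of_real_ge0 ?ltW// -nrmE.
Qed.

(** Values in a compact interval have a cluster point, and along an ultrafilter a cluster point is a
    limit. *)
Lemma bounded_ultra_cvg_real (T : Type) (F : set_system T) (FU : UltraFilter F)
    (g : T -> R) (M : R) : F [set x | `|g x| <= M] -> exists l : R, g @ F --> l.
Proof.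
move=> FM; have := @segment_compact R (- M) M.
move=> /(_ (g @ F) _)[|l [_ lF]].
  apply: (@filterS _ F _ _ _ _ FM) => x gM.
  by rewrite /= in_itv/=; move: gM; rewrite /= ler_norml.
exists l => U Ul.
have [//|FU'] := in_ultra_setVsetC (g @^-1` U) FU.
by have [y []] := lF (~` U) U FU' Ul.
Qed.

Lemma scalars_split (a b : R) : (k = RealScalars -> b = 0) ->
  exists2 l : K, scalars_re l = a & scalars_im l = b.
Proof.
rewrite /scalars_im; case: k => [/(_ erefl) ->|_]; first by exists a.
by exists (a +i* b)%C.
Qed.

Lemma scalars_reB (x y : K) : scalars_re (x - y) = scalars_re x - scalars_re y.
Proof. by case: k x y => //= -[a b] [c d]. Qed.

Lemma scalars_imB (x y : K) : scalars_im (x - y) = scalars_im x - scalars_im y.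
Proof. by rewrite /scalars_im; case: k x y => /= [x y|[a b] [c d]//]; rewrite subrr. Qed.

Lemma bounded_ultra_cvg (T : Type) (F : set_system T) (FU : UltraFilter F)
    (f : T -> K^o) (M : R) : F [set x | nrm (f x : K) <= M] ->
  exists l : K^o, f @ F --> l.
Proof.
move=> FM.
have [a fa] := bounded_ultra_cvg_real (g := fun x => scalars_re (f x)) FU
  (filterS (fun x => le_trans (re_le_nrm _)) FM).
have [b fb] := bounded_ultra_cvg_real (g := fun x => scalars_im (f x)) FU
  (filterS (fun x => le_trans (im_le_nrm _)) FM).
have b0 : k = RealScalars -> b = 0.
  move=> k0; have im0 x : scalars_im (f x) = 0.
    by rewrite /scalars_im; move: (f x); case: k k0.
  have f0 : (fun x => scalars_im (f x)) @ F --> (0 : R).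
    by rewrite (_ : (fun x => _) = cst 0); [exact: cvg_cst|apply/funext].
  exact: (@cvg_unique _ (@Rhausdorff R) _ _ _ _ fb f0).
have [l la lb] := scalars_split a b0.
exists l; apply/cvg_nrmP => e e0.
move/cvgrPdist_lt : fa => /(_ _ (divr_gt0 e0 (ltr0Sn _ 1))) fa.
move/cvgrPdist_lt : fb => /(_ _ (divr_gt0 e0 (ltr0Sn _ 1))) fb.
near=> x; apply: le_lt_trans (nrm_le_re_im _) _.
rewrite scalars_reB scalars_imB la lb [e]splitr ltrD//.
  by near: x.
by near: x.
Unshelve. all: by end_near. Qed.

Lemma scalars_hausdorff : hausdorff_space (K^o : topologicalType).
Proof. exact: norm_hausdorff. Qed.

(** A Cauchy sequence is bounded, so it converges along an ultrafilter finer than [\oo]; the Cauchy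
    condition carries the limit over to the whole sequence. *)
Lemma cauchy_scalars_cvg (u : nat -> K^o) :
  (forall e : R, 0 < e -> exists N, forall i j, (N <= i)%N -> (N <= j)%N ->
     nrm (u i - u j : K) < e) -> exists l : K^o, u @ \oo --> l.
Proof.
move=> cu; have [G [GU ooG]] := ultraFilterLemma (F := \oo : set_system nat) _.
have [N0 uN0] := cu 1 ltr01.
have [l ul] : exists l : K^o, u @ G --> l.
  apply: (bounded_ultra_cvg GU (M := nrm (u N0 : K) + 1)).
  apply: ooG; exists N0 => // j /= Nj.
  have := nrm_dist (u j : K) (u N0); have := uN0 j N0 Nj (leqnn _).
  by move=> h1 h2; rewrite -lerBlDl (le_trans h2)// ltW.
exists l; apply/cvg_nrmP => e e0.
have e20 : 0 < e / 2 by rewrite divr_gt0.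
have [N uN] := cu _ e20; exists N => // i /= Ni.
move/(cvg_nrmP _ u l) : ul => /(_ _ e20) ul.
have GN : G [set j | (N <= j)%N] by apply: ooG; exists N.
have [j [/= lj Nj]] := filter_ex (filterI ul GN).
have -> : l - u i = (l - u j) + (u j - u i) by rewrite addrA subrK.
rewrite [e]splitr; apply: le_lt_trans (nrmD _ _) _; apply: ltrD => //.
exact: uN.
Qed.

End Scalars.

(** * Hahn-Banach theorem for seminorms *)

Section Realification.
Variables (R : realType) (k : field_kind) (V : lmodType (scalars R k)).

(** A type alias, so that multiplication by reals does not compete with the scalar multiplication of
    [V]. *)
Definition realified : Type := V.

HB.instance Definition _ := GRing.Zmodule.on realified.

Definition real_scale (t : R) (v : realified) : realified := of_real k t *: (v : V).

Lemma real_scaleA a b v : real_scale a (real_scale b v) = real_scale (a * b) v.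
Proof. by rewrite /real_scale scalerA of_realM. Qed.

Lemma real_scale1 : left_id 1 real_scale.
Proof. by move=> v; rewrite /real_scale of_real1 scale1r. Qed.

Lemma real_scaleDr : right_distributive real_scale +%R.
Proof. by move=> a u v; rewrite /real_scale scalerDr. Qed.

Lemma real_scaleDl v : {morph real_scale^~ v : a b / a + b}.
Proof. by move=> a b; rewrite /real_scale of_realD scalerDl. Qed.

HB.instance Definition _ := GRing.Zmodule_isLmodule.Build R realified
  real_scaleA real_scale1 real_scaleDr real_scaleDl.

End Realification.

(** Over the complex numbers this is the Bohnenblust-Sobczyk formula [g v = f v - i f (i v)]. *)
Lemma real_part_functional (R : realType) (k : field_kind)
    (V : lmodType (scalars R k)) (f : {scalar realified V}) :
  exists g : V -> (scalars R k)^o, linear g /\ forall v, scalars_re (g v) = f v.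
Proof.
case: k V f => V f.
  by exists f; split=> // a u v; exact: (linearP f).
have fD (u v : V) : f (u + v) = f u + f v by exact: (linearD f).
have fZ (t : R) (v : V) : f ((t%:C)%C *: v) = t * f v by exact: (linearZ_LR f t v).
exists (fun v => ((f v : R) +i* - (f ('i%C *: v) : R))%C); split=> //.
move=> -[a b] u v.
have E (w : V) : (a +i* b)%C *: w = (a%:C)%C *: w + (b%:C)%C *: ('i%C *: w).
  rewrite scalerA -scalerDl; congr (_ *: _).
  by apply/eqP; rewrite eq_complex/=; apply/andP; split; apply/eqP; ring.
have Ei (w : V) : 'i%C *: ((a +i* b)%C *: w) = (a%:C)%C *: ('i%C *: w) + ((- b)%:C)%C *: w.
  rewrite !scalerA -scalerDl; congr (_ *: _).
  by apply/eqP; rewrite eq_complex/=; apply/andP; split; apply/eqP; ring.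
rewrite scalerDr !fD Ei E !fD !fZ.
apply/eqP; rewrite eq_complex /=; apply/andP; split; apply/eqP; rewrite /GRing.scale/=; ring.
Qed.

(** The cone of requirements is the ray through [(v0, N v0)], which forces the real functional to
    reach [N v0] at [v0]. Rotating [v] by a unimodular scalar makes [g] real and nonnegative there,
    so the bound on the real part becomes a bound on the modulus. *)
Theorem hahn_banach_seminorm (R : realType) (k : field_kind)
    (V : lmodType (scalars R k)) (N : V -> R) (v0 : V) :
  (forall u v, N (u + v) <= N u + N v) ->
  (forall c v, N (c *: v) = nrm c * N v) ->
  exists g : V -> (scalars R k)^o,
    [/\ linear g, forall v, nrm (g v : scalars R k) <= N v
      & N v0 <= nrm (g v0 : scalars R k)].
Proof.
move=> ND NZ.
have NZr t (v : V) : 0 <= t -> N (of_real k t *: v) = t * N v.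
  by move=> t0; rewrite NZ nrm_of_real ger0_norm.
pose Q := [set ((t *: (v0 : realified V)), t * N v0) | t in [set t : R | 0 <= t]].
have [||f [fN fQ]] := @mazur_orlicz R (realified V) N Q.
- by split; [exact: ND|move=> t v; exact: NZr].
- split.
  + by exists 0 => //=; rewrite scale0r mul0r.
  + move=> _ _ [s s0 <-] [t t0 <-]; exists (s + t) => /=; first exact: addr_ge0.
    by rewrite scalerDl mulrDl.
  + move=> t _ t0 [s s0 <-]; exists (t * s) => /=; first exact: mulr_ge0.
    by rewrite scalerA mulrA.
  + by move=> _ [t t0 <-] /=; rewrite NZr.
have [g [gl gf]] := real_part_functional f.
exists g; split=> // [v|].
  have [c c1 cg] := unimodularP (g v : scalars R k).
  have gc : g (c *: v) = of_real k (nrm (g v : scalars R k)).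
    rewrite -cg; have := gl c v 0; rewrite addr0 => ->.
    have := gl 1 0 0; rewrite scaler0 addr0 scale1r => /esym/eqP.
    by rewrite -subr_eq0 addrK => /eqP ->; rewrite addr0.
  rewrite -[leLHS](@of_realK R k) -gc gf (le_trans (fN _))//.
  by rewrite NZ c1 mul1r.
have := fQ (1 *: (v0 : realified V), 1 * N v0) (ex_intro2 _ _ 1 ler01 erefl).
rewrite /= scale1r mul1r -gf => /le_trans; apply.
exact: le_trans (ler_norm _) (re_le_nrm _).
Qed.

(** * Weak* topologies *)

Section WeakStar.
Variables (R : realType) (k : field_kind) (E' : choiceType) (E : Type).
Local Notation K := (scalars R k).
Variable pairing : E' -> E -> K^o.
Local Notation W := (wstar pairing).

Lemma wstar_continuous (e : E) : continuous (fun f : W => pairing f e).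
Proof.
move=> f; apply: (@continuous_comp W {ptws E -> K^o} K^o pairing (fun g => g e)).
  exact: (@initial_continuous E' {ptws E -> K^o} pairing).
pose E1 : eqType := HB.pack E (gen_eqMixin E).
exact: (@proj_continuous E1 (fun=> K^o) e).
Qed.

Lemma wstar_cvg (F : set_system W) (FF : Filter F) (f : W) :
  (forall e, pairing g e @[g --> F] --> pairing f e) -> F --> f.
Proof.
move=> Fe U [? /= [[G oG <-]] Gf GU]; rewrite nbhs_simpl.
have cvgG : {ptws, (fmap pairing F) --> (pairing f : E -> K^o)}.
  apply/cvg_sup => e V [? /= [[P oP <-]] Pf PV]; rewrite nbhs_simpl.
  by apply: filterS PV _; apply: (Fe e); exact: open_nbhs_nbhs.
by apply: filterS GU _; apply: cvgG; exact: open_nbhs_nbhs.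
Qed.

Lemma wstar_hausdorff : (forall f g, (forall e, pairing f e = pairing g e) -> f = g) ->
  hausdorff_space W.
Proof.
move=> inj f g fg; apply: inj => e; apply: (@scalars_hausdorff R k) => A B Af Bg.
have [h [Ah Bh]] := fg _ _ (wstar_continuous Af) (wstar_continuous Bg).
by exists (pairing h e).
Qed.

(** Alaoglu's argument with ultrafilters: pointwise boundedness makes an ultrafilter on [A] converge
    at each [e], and the second hypothesis realises the pointwise limit by an element of [A]. *)
Lemma wstar_compact (A : set W) :
  (forall e, exists M : R, forall f, A f -> nrm (pairing f e : K) <= M) ->
  (forall (F : set_system E') (FU : UltraFilter F) (l : E -> K^o), F A ->
     (forall e, pairing g e @[g --> F] --> l e) ->
     exists2 f, A f & forall e, pairing f e = l e) ->
  compact A.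
Proof.
move=> bA limA; rewrite compact_ultra => F FU FA.
have /choice[l Fl] : forall e, exists l : K^o, pairing g e @[g --> F] --> l.
  move=> e; have [M AM] := bA e.
  by apply: (bounded_ultra_cvg FU (M := M)); apply: filterS FA => f; exact: AM.
have [f Af fl] := limA F FU l FA Fl; exists f; split=> //.
by apply: wstar_cvg => e; rewrite fl.
Qed.

End WeakStar.

Section Subspace.
Variables (T : topologicalType) (A : set T) (A0 : A !=set0).

Lemma subspace_of_compact : compact A -> compact [set: subspace_of A0].
Proof.
move=> cA F FF _; have [|p [Ap Fp]] := cA (fmap set_val F) _.
  by apply: (@filterS _ F _ setT _ _ filterT) => x _; exact: set_valP.
exists (exist _ p (mem_set Ap)); split=> // U V FU [? /= [[G oG <-]] Gp GV].
have [|_ [[u Uu <-] Gu]] := Fp (set_val @` U) G _ (open_nbhs_nbhs (conj oG Gp)).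
  by apply: (@filterS _ F _ U _ _ FU) => u Uu; exists u.
by exists u; split=> //; exact: GV.
Qed.

Lemma subspace_of_continuous (U : topologicalType) (f : T -> U) :
  continuous f -> continuous (fun x : subspace_of A0 => f (\val x)).
Proof.
move=> cf x; apply: (@continuous_comp (subspace_of A0) T U (fun x => \val x) f).
  exact: (@initial_continuous (set_type A) T set_val).
exact: cf.
Qed.

Lemma subspace_of_hausdorff : hausdorff_space T -> hausdorff_space (subspace_of A0).
Proof.
move=> hT x y xy; apply: val_inj; apply: hT => U V Ux Vy.
have cv : continuous (fun x : subspace_of A0 => \val x).
  exact: (@initial_continuous (set_type A) T set_val).
have [z [Uz Vz]] := xy _ _ (cv _ _ Ux) (cv _ _ Vy).
by exists (\val z).
Qed.

End Subspace.

(** * Multilinear forms and the projective norm *)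

Section MultilinearForms.
Variables (R : realType) (k : field_kind) (n : nat).
Local Notation K := (scalars R k).
Variable X : 'I_n -> completeNormedModType K.
Implicit Types (x : forall i, X i) (f : form_on (mforms (X := X))).

Lemma dfwith_same x i : dfwith x i (x i) = x.
Proof.
apply: functional_extensionality_dep => j.
by case: dfwithP.
Qed.

Lemma form_multilinear f x i c (u v : X i) :
  set_val f (dfwith x i (c *: u + v)) =
  c * set_val f (dfwith x i u) + set_val f (dfwith x i v).
Proof. exact: (set_valP f). Qed.

Lemma form_zero f x i : x i = 0 -> set_val f x = 0.
Proof.
move=> xi0; rewrite -(dfwith_same x i) xi0.
have := form_multilinear f x 1 (0 : X i) 0.
rewrite scaler0 addr0 mul1r => /eqP; rewrite -subr_eq0 opprD addNKr.
by rewrite oppr_eq0 => /eqP.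
Qed.

Lemma form_scale f x i c (u : X i) :
  set_val f (dfwith x i (c *: u)) = c * set_val f (dfwith x i u).
Proof.
rewrite -[c *: u]addr0 form_multilinear [X in _ + X](@form_zero _ _ i) ?addr0//.
by rewrite dfwithin.
Qed.

Lemma form_scale_all f x (c : 'I_n -> K) :
  set_val f (fun i => c i *: x i) = (\prod_i c i) * set_val f x.
Proof.
(* The coordinates are scaled one at a time; in [y s] those listed in [s] have been treated. *)
pose y (s : seq 'I_n) : forall i, X i := fun i => if i \in s then c i *: x i else x i.
have E s : uniq s -> set_val f (y s) = (\prod_(i <- s) c i) * set_val f x.
  elim: s => [_|j s IH /= /andP[js us]].
    by rewrite big_nil mul1r; congr (set_val f _); apply: functional_extensionality_dep.
  rewrite big_cons -mulrA -IH//.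
  have -> : y (j :: s) = dfwith (y s) j (c j *: x j).
    apply: functional_extensionality_dep => i; case: dfwithP => [|i' ji].
      by rewrite /y mem_head.
    by rewrite /y in_cons eq_sym (negbTE ji).
  rewrite form_scale; congr (_ * set_val f _).
  rewrite -[RHS](dfwith_same _ j); congr dfwith.
  by rewrite /y (negbTE js).
have := E (index_enum 'I_n) (index_enum_uniq _).
rewrite (_ : y _ = fun i => c i *: x i) => [->//|].
by apply: functional_extensionality_dep => i; rewrite /y mem_index_enum.
Qed.

(** A zero coordinate annihilates the form; otherwise every coordinate is divided by its norm and
    the factors are pulled out by [form_scale_all]. *)
Lemma form_bound f (M : R) : 0 <= M ->
  (forall x, (forall i, nrm (x i) <= 1) -> nrm (set_val f x) <= M) ->
  forall x, nrm (set_val f x) <= M * \prod_i nrm (x i).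
Proof.
move=> M0 fM x; have [/existsP[i /eqP xi0]|/existsPn x0] := boolP [exists i, x i == 0].
  by rewrite (form_zero f xi0) nrm0 mulr_ge0// prodr_ge0// => j _; exact: nrm_ge0.
pose c i := of_real k (nrm (x i)).
have c0 i : c i != 0 by rewrite /c -(nrm_eq0 (c i)) nrm_of_real normr_eq0 nrm_eq0 x0.
have -> : x = fun i => c i *: ((c i)^-1 *: x i).
  by apply: functional_extensionality_dep => i; rewrite scalerA mulfV// scale1r.
rewrite form_scale_all nrm_scalarM mulrC; apply: ler_pM; rewrite ?nrm_ge0//.
  apply: fM => i.
  have : nrm (c i *: ((c i)^-1 *: x i)) = nrm (x i) by rewrite scalerA mulfV// scale1r.
  rewrite nrmZ nrm_of_real ger0_norm ?nrm_ge0// => /(canRL (mulKf _)) ->.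
    by rewrite mulVf// nrm_eq0 x0.
  by rewrite nrm_eq0 x0.
rewrite (big_morph (fun z : K => nrm z) (@nrm_scalarM R k) (@nrm1 R k)).
rewrite le_eqVlt; apply/orP; left; apply/eqP; apply: eq_bigr => i _.
by rewrite scalerA mulfV// scale1r nrm_of_real ger0_norm// nrm_ge0.
Qed.

Lemma mball_form_le (psi : mdual X) x : mball X psi ->
  nrm (set_val (set_val psi) x) <= \prod_i nrm (x i).
Proof.
move=> psi1; rewrite -[leRHS]mul1r; apply: form_bound => // {}x x1.
rewrite -lee_fin (le_trans _ psi1)//; apply: ereal_sup_ubound.
by exists x.
Qed.

Lemma mform_mball f : (forall x, nrm (set_val f x) <= \prod_i nrm (x i)) ->
  exists2 psi : mdual X, mball X psi & set_val psi = f.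
Proof.
move=> fM; have f1 : (mnorm f <= 1)%E.
  apply: ge_ereal_sup => _ [x x1 <-]; rewrite lee_fin (le_trans (fM x))//.
  by apply: prodr_ile1 => i _; rewrite nrm_ge0 x1.
have fb : bounded_mforms f by rewrite /bounded_mforms/= (le_lt_trans f1)// ltry.
by exists (exist _ f (mem_set fb)).
Qed.

Lemma mpairD (psi : mdual X) u v : mpair psi (u + v) = mpair psi u + mpair psi v.
Proof. by []. Qed.

Lemma mpairB (psi : mdual X) u v : mpair psi (u - v) = mpair psi u - mpair psi v.
Proof. by []. Qed.

Lemma mpair0 (psi : mdual X) : mpair psi 0 = 0.
Proof. by []. Qed.

Lemma mpair_sum (psi : mdual X) (I : Type) (s : seq I) (u : I -> mtensor X) :
  mpair psi (\sum_(i <- s) u i) = \sum_(i <- s) mpair psi (u i).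
Proof. exact: (big_morph _ (mpairD psi) (mpair0 psi)). Qed.

End MultilinearForms.

Section ProjectiveNorm.
Variables (R : realType) (k : field_kind) (n : nat).
Local Notation K := (scalars R k).
Hypothesis n0 : (0 < n)%N.
Variable X : 'I_n -> completeNormedModType K.
Implicit Types (u v : mtensor X) (x : forall i, X i).

(** The scalar is absorbed into the first coordinate. This is where [n] must be positive: for
    [n = 0] there is a single elementary tensor, and its multiples are not elementary. *)
Lemma prod_nrm_scale c x :
  exists2 y, mtens y = c *: mtens x & \prod_i nrm (y i) = nrm c * \prod_i nrm (x i).
Proof.
pose i0 := Ordinal n0; exists (dfwith x i0 (c *: x i0)).
  apply: val_inj; apply/funext => f.
  have := form_scale f x c (x i0); rewrite dfwith_same; exact.
rewrite (bigD1 i0)//= dfwithin nrmZ -mulrA; congr (_ * _).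
rewrite [RHS](bigD1 i0)//=; congr (_ * _); apply: eq_bigr => i ii0.
by rewrite dfwithout// eq_sym.
Qed.

Lemma mtens_scale c x : exists y, mtens y = c *: mtens x.
Proof. by have [y yE _] := prod_nrm_scale c x; exists y. Qed.

Lemma decomposableZ c u : decomposable u -> decomposable (c *: u).
Proof. by move=> [x _ <-]; have [y yx] := mtens_scale c x; exists y. Qed.

Lemma decomposable0 : decomposable (0 : mtensor X).
Proof. by rewrite -(scale0r (mtens (fun i => 0))); apply: decomposableZ; exists (fun i => 0). Qed.

Lemma mtensor_rep u : exists (m : nat) (x : 'I_m -> forall i, X i),
  u = \sum_(j < m) mtens (x j).
Proof.
have [s ->] := tensor_gen u.
have /choice[y yE] : forall c : K * (forall i, X i), exists y, mtens y = c.1 *: mtens c.2.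
  by move=> c; exact: mtens_scale.
exists (size s), (fun j => y (tnth (in_tuple s) j)).
rewrite (big_tnth _ _ s); apply: eq_bigr => j _; rewrite yE.
by [].
Qed.

Definition pn u : R := fine (proj_norm u).

Lemma prod_nrm_ge0 x : 0 <= \prod_i nrm (x i).
Proof. by apply: prodr_ge0 => i _; exact: nrm_ge0. Qed.

Lemma proj_normE u : proj_norm u = (pn u)%:E.
Proof.
rewrite /pn fineK// ge0_fin_numE.
  have [m [x ux]] := mtensor_rep u.
  apply: (@le_lt_trans _ _ (\sum_(j < m) \prod_(i < n) nrm (x j i))%:E); last exact: ltry.
  by apply: ereal_inf_lbound; exists m, x.
apply: le_ereal_inf_tmp => _ [m [x [_ ->]]]; rewrite lee_fin.
by apply: sumr_ge0 => j _; exact: prod_nrm_ge0.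
Qed.

Lemma pn_ge0 u : 0 <= pn u.
Proof.
rewrite -lee_fin -proj_normE; apply: le_ereal_inf_tmp => _ [m [x [_ ->]]]; rewrite lee_fin.
by apply: sumr_ge0 => j _; exact: prod_nrm_ge0.
Qed.

Lemma pn_le m (x : 'I_m -> forall i, X i) :
  pn (\sum_(j < m) mtens (x j)) <= \sum_(j < m) \prod_(i < n) nrm (x j i).
Proof. by rewrite -lee_fin -proj_normE; apply: ereal_inf_lbound; exists m, x. Qed.

Lemma pn_glb u (c : R) : (forall m (x : 'I_m -> forall i, X i),
  u = \sum_(j < m) mtens (x j) -> c <= \sum_(j < m) \prod_(i < n) nrm (x j i)) ->
  c <= pn u.
Proof.
move=> H; rewrite -lee_fin -proj_normE; apply: le_ereal_inf_tmp => _ [m [x [ux ->]]].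
by rewrite lee_fin H.
Qed.

Lemma pn_mtens x : pn (mtens x) <= \prod_i nrm (x i).
Proof. by have := pn_le (fun _ : 'I_1 => x); rewrite !big_ord1. Qed.

Lemma pnD u v : pn (u + v) <= pn u + pn v.
Proof.
rewrite -lerBlDr; apply: pn_glb => m x ux; rewrite lerBlDr -lerBlDl.
apply: pn_glb => l y vy; rewrite lerBlDl.
have -> : u + v = \sum_(j < m + l) mtens (match fintype.split j with inl a => x a | inr b => y b end).
  rewrite big_split_ord/= ux vy; congr (_ + _); apply: eq_bigr => j _.
    by rewrite (unsplitK (inl j)).
  by rewrite (unsplitK (inr j)).
apply: le_trans (pn_le _) _; rewrite big_split_ord/=; apply: lerD.
  by rewrite le_eqVlt; apply/orP; left; apply/eqP/eq_bigr => j _; rewrite (unsplitK (inl j)).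
by rewrite le_eqVlt; apply/orP; left; apply/eqP/eq_bigr => j _; rewrite (unsplitK (inr j)).
Qed.

Lemma pnZ_le c u : pn (c *: u) <= nrm c * pn u.
Proof.
have [->|c0] := eqVneq c 0.
  rewrite scale0r nrm0 mul0r; have := pn_le (fun j : 'I_0 => fun i : 'I_n => (0 : X i)).
  by rewrite !big_ord0.
have c0' : 0 < nrm c by rewrite lt_neqAle nrm_ge0 eq_sym nrm_eq0 c0.
rewrite -ler_pdivrMl//; apply: pn_glb => m x ux; rewrite ler_pdivrMl//.
have /choice[y yE] : forall j, exists y, mtens y = c *: mtens (x j) /\
    \prod_i nrm (y i) = nrm c * \prod_i nrm (x j i).
  by move=> j; have [y ? ?] := prod_nrm_scale c (x j); exists y.
rewrite ux scaler_sumr (eq_bigr (fun j => mtens (y j))); last first.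
  by move=> j _; have [] := yE j.
apply: le_trans (pn_le _) _; rewrite mulr_sumr; apply: ler_sum => j _.
by have [_ ->] := yE j.
Qed.

Lemma pnZ c u : pn (c *: u) = nrm c * pn u.
Proof.
apply/eqP; rewrite eq_le pnZ_le/=; have [->|c0] := eqVneq c 0.
  by rewrite nrm0 mul0r pn_ge0.
have nc0 : nrm c != 0 by rewrite nrm_eq0.
rewrite -{1}(scale1r u) -(mulVf c0) -scalerA.
apply: le_trans (ler_wpM2l (nrm_ge0 c) (pnZ_le _ _)) _.
rewrite mulrA -nrm_scalarM mulfV// nrm1 mul1r//.
Qed.

Lemma pn0 : pn (0 : mtensor X) = 0.
Proof. by rewrite -(scale0r 0) pnZ nrm0 mul0r. Qed.

Lemma mpair_le (psi : mdual X) u : mball X psi -> nrm (mpair psi u) <= pn u.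
Proof.
move=> psi1; apply: pn_glb => m x ->; rewrite mpair_sum (le_trans (nrm_sum _ _))//.
by apply: ler_sum => j _; exact: mball_form_le.
Qed.

(** The converse of [mpair_le]. Hahn-Banach and pointwise limits both deliver a linear functional on
    the tensor product; this turns it into a multilinear form in the unit ball. *)
Lemma mball_of_linear (g : mtensor X -> K^o) : linear g ->
  (forall u, nrm (g u : K) <= pn u) ->
  exists2 psi : mdual X, mball X psi & forall u, mpair psi u = g u.
Proof.
move=> gl gp; pose f x : K := g (mtens x).
have fP : mforms (X := X) f.
  by move=> x i c u v; rewrite /f mtens_multilinear gl.
have fM x : nrm (f x) <= \prod_i nrm (x i) by rewrite (le_trans (gp _))// pn_mtens.
have [psi psi1 psif] := @mform_mball _ _ _ X (exist _ f (mem_set fP)) fM.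
exists psi => // u; have [m [x ->]] := mtensor_rep u.
have gD a b : g (a + b) = g a + g b by have := gl 1 a b; rewrite !scale1r.
have g0 : g 0 = 0.
  by have /eqP := gD 0 0; rewrite addr0 -subr_eq0 opprD addNKr oppr_eq0 => /eqP.
rewrite mpair_sum (big_morph _ gD g0); apply: eq_bigr => j _.
by rewrite /mpair psif.
Qed.

Lemma mball_norming u : exists2 psi : mdual X, mball X psi & pn u <= nrm (mpair psi u).
Proof.
have [g [gl gp gu]] := @hahn_banach_seminorm R k (mtensor X) pn u pnD pnZ.
by have [psi psi1 psig] := mball_of_linear gl gp; exists psi; rewrite // psig.
Qed.

End ProjectiveNorm.

(** * Banach-Alaoglu theorem and norming balls *)

Lemma linear_functionalD (R : realType) (k : field_kind) (V : lmodType (scalars R k))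
  (g : V -> (scalars R k)^o) : linear g -> forall a b, g (a + b) = g a + g b.
Proof. by move=> gl a b; have := gl 1 a b; rewrite !scale1r. Qed.

Lemma nrm_le_eps (R : realType) (k : field_kind) (V : normedZmodType (scalars R k)) (v : V) :
  (forall e : R, 0 < e -> nrm v <= e) -> v = 0.
Proof.
move=> ve; apply/eqP; rewrite -nrm_eq0 eq_le nrm_ge0 andbT.
by apply/ler_addgt0Pr => e e0; rewrite add0r ve.
Qed.

Section UltraLimit.
Variables (R : realType) (k : field_kind) (T : Type).
Local Notation K := (scalars R k).
Context (F : set_system T) {FF : ProperFilter F}.

Lemma limit_linear (V : lmodType K) (h : T -> V -> K^o) (l : V -> K^o) :
  (forall t, linear (h t)) -> (forall v, h t v @[t --> F] --> l v) -> linear l.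
Proof.
move=> hl hv c u v; apply: (@cvg_unique _ (@scalars_hausdorff R k) (h t (c *: u + v) @[t --> F])).
  exact: hv.
rewrite (_ : (fun t => h t (c *: u + v)) = fun t => c *: h t u + h t v); last first.
  by apply/funext => t; exact: hl.
by apply: cvgD; [apply: (@cvgZl_tmp); exact: hv|exact: hv].
Qed.

Lemma limit_nrm_le (f : T -> K^o) (l : K^o) (M : R) (A : set T) :
  F A -> (forall t, A t -> nrm (f t : K) <= M) -> f t @[t --> F] --> l ->
  nrm (l : K) <= M.
Proof.
move=> FA AM /cvg_nrmP fl; apply/ler_addgt0Pr => e e0.
have [t [At lt]] := filter_ex (filterI FA (fl e e0)).
rewrite -(subrK (f t) l) (le_trans (nrmD _ _))// addrC lerD ?AM//.
exact: ltW.
Qed.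

End UltraLimit.

Section CompletedTensor.
Variables (R : realType) (k : field_kind) (n : nat).
Local Notation K := (scalars R k).
Hypothesis n0 : (0 < n)%N.
Variable X : 'I_n -> completeNormedModType K.
Implicit Types (u : mtensor X) (w : ctensor X) (psi : mdual X).

Lemma cst_cauchy u : proj_cauchy (fun=> u).
Proof. by move=> e e0; exists 0%N => i j _ _; rewrite subrr proj_normE// pn0// lte_fin. Qed.

Definition cst_ctensor u : ctensor X := exist _ (fun=> u) (mem_set (cst_cauchy u)).

Lemma cpair_cst psi u : cpair X psi (cst_ctensor u) = mpair psi u.
Proof. by apply: (@cvg_lim _ (@scalars_hausdorff R k)); exact: cvg_cst. Qed.

Lemma cnorm_cst u : cnorm X (cst_ctensor u) = proj_norm u.
Proof.
apply: (@cvg_lim _ (@ereal_hausdorff R)).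
exact: (@cvg_cst (\bar R) (proj_norm u) nat \oo).
Qed.

Lemma norming_adherent (A : set (mdual X)) u (e : R) :
  norming (cpair X) (cnorm X) A -> 0 < e ->
  exists2 psi, A psi & pn u - e <= nrm (mpair psi u).
Proof.
move=> [_ /(_ (cst_ctensor u))]; rewrite cnorm_cst proj_normE// => uA e0.
have [|_ [psi Apsi <-]] := @ub_ereal_sup_adherent _
   [set (nrm (cpair X f (cst_ctensor u)))%:E | f in A] e e0 _.
  by rewrite -uA.
rewrite -uA cpair_cst -EFinB lte_fin => /ltW ?.
by exists psi.
Qed.

Lemma ctensor_cauchy w (e : R) : 0 < e -> exists N, forall i j,
  (N <= i)%N -> (N <= j)%N -> pn (set_val w i - set_val w j) < e.
Proof.
move=> e0; have [N wN] := set_valP w e e0; exists N => i j Ni Nj.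
by rewrite -lte_fin -proj_normE// wN.
Qed.

Lemma cpair_cvg psi w : mball X psi ->
  mpair psi (set_val w j) @[j --> \oo] --> cpair X psi w.
Proof.
move=> psi1; have [l wl] : exists l : K^o, (mpair psi (set_val w j) : K^o) @[j --> \oo] --> l.
  apply: cauchy_scalars_cvg => e e0; have [N wN] := ctensor_cauchy w e0.
  exists N => i j Ni Nj; rewrite -mpairB (le_lt_trans (mpair_le n0 _ psi1))//.
  exact: wN.
by rewrite /cpair (cvg_lim (@scalars_hausdorff R k) wl).
Qed.

(** One [N] serves the whole ball. This uniformity reduces statements about the completion to the
    algebraic tensor product. *)
Lemma cpair_approx w (e : R) : 0 < e -> exists N, forall j, (N <= j)%N ->
  forall psi, mball X psi -> nrm (cpair X psi w - mpair psi (set_val w j) : K) <= e.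
Proof.
move=> e0; have [N wN] := ctensor_cauchy w e0; exists N => j Nj psi psi1.
apply: (@limit_nrm_le R k nat \oo _ (fun i => mpair psi (set_val w i) - mpair psi (set_val w j))
  _ _ [set i | (N <= i)%N]).
- by exists N.
- move=> i /= Ni; rewrite -mpairB (le_trans (mpair_le n0 _ psi1))// ltW//.
  exact: wN.
- by apply: cvgB; [exact: cpair_cvg|exact: cvg_cst].
Qed.

Lemma cnorm_approx w : exists2 c : R, cnorm X w = c%:E &
  forall e : R, 0 < e -> exists N, forall j, (N <= j)%N -> `|pn (set_val w j) - c| <= e.
Proof.
have pnN (v : mtensor X) : pn (- v) = pn v.
  by have := pnZ n0 (-1) v; rewrite scaleN1r nrmN nrm1 mul1r.
have pnB u v : `|pn u - pn v| <= pn (u - v).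
  have H (a b : mtensor X) : pn a - pn b <= pn (a - b).
    by rewrite lerBlDr -{1}(subrK b a) pnD.
  rewrite ler_norml H andbT lerNl opprB (le_trans (H _ _))//.
  by rewrite -[v - u]opprB pnN.
have [c wc] : exists c : R^o, (pn (set_val w j) : R^o) @[j --> \oo] --> c.
  apply: (@cauchy_scalars_cvg R RealScalars) => e e0.
  have [N wN] := ctensor_cauchy w e0; exists N => i j Ni Nj.
  by rewrite (le_lt_trans (pnB _ _))// wN.
exists c.
  apply: (@cvg_lim _ (@ereal_hausdorff R)); rewrite (_ : (fun j => _) = fun j => (pn (set_val w j))%:E).
    by apply: cvg_EFin; [exact: nearW|exact: wc].
  by apply/funext => j; rewrite proj_normE.
move=> e e0; move/(@cvg_nrmP R RealScalars) : wc => /(_ _ e0)[N _ wN].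
exists N => j Nj; rewrite distrC ltW//; exact: (wN j Nj).
Qed.

Lemma mball_compact : compact (mball X : set (wstar_mdual X)).
Proof.
apply: wstar_compact => [w|F FU l FB Fl].
  have [N wN] := cpair_approx w ltr01.
  exists (1 + pn (set_val w N)) => psi psi1.
  rewrite -(subrK (mpair psi (set_val w N)) (cpair X psi w)) (le_trans (nrmD _ _))// lerD//.
    exact: wN.
  exact: mpair_le.
have Fg u : mpair psi u @[psi --> F] --> l (cst_ctensor u).
  by have := Fl (cst_ctensor u); under eq_fun do rewrite cpair_cst.
(* The limit is identified first on constant sequences, where it is linear and bounded by [pn];
   [cpair_approx] then extends the identity to all Cauchy sequences. *)
have [|u|psi0 psi01 psi0g] := @mball_of_linear _ _ _ n0 X (fun u => l (cst_ctensor u)).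
- exact: (limit_linear (h := fun psi u => mpair psi u) _ Fg).
- by apply: (limit_nrm_le FB _ (Fg u)) => psi; exact: mpair_le.
exists psi0 => // w; apply/eqP; rewrite -subr_eq0; apply/eqP/nrm_le_eps => e e0.
have e20 : 0 < e / 2 by rewrite divr_gt0.
have [N wN] := cpair_approx w e20.
have -> : cpair X psi0 w - l w = (cpair X psi0 w - mpair psi0 (set_val w N)) -
    (l w - l (cst_ctensor (set_val w N))).
  by rewrite psi0g opprB addrA subrK.
rewrite [e]splitr (le_trans (nrmD _ _))// lerD//; first exact: wN.
rewrite nrmN; apply: (limit_nrm_le FB (wN N (leqnn N)) (cvgB (Fl w) (Fg _))).
Qed.

(** On the algebraic tensor product this is Hahn-Banach. A late term of the Cauchy sequence
    approximates its norm and, simultaneously, its pairings with the whole ball. *)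
Lemma mball_cnorming : norming (cpair X) (cnorm X) (mball X).
Proof.
split; first by have [psi psi1 _] := mball_norming n0 (0 : mtensor X); exists psi.
move=> w; have [c -> wc] := cnorm_approx w.
apply/eqP; rewrite eq_le; apply/andP; split.
  apply/lee_addgt0Pr => e e0; have e20 : 0 < e / 2 by rewrite divr_gt0.
  have [N wN] := cpair_approx w e20; have [M wM] := wc _ e20.
  pose j := maxn N M; have [psi psi1 jpsi] := mball_norming n0 (set_val w j).
  apply: (@le_trans _ _ ((nrm (cpair X psi w))%:E + e%:E)%E); last first.
    by rewrite leeD2r//; apply: ereal_sup_ubound; exists psi.
  rewrite -EFinD lee_fin.
  have := wN j (leq_maxl _ _) psi psi1; have := wM j (leq_maxr _ _).
  rewrite ler_norml => /andP[h1 _] h2.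
  have := nrm_dist (mpair psi (set_val w j)) (cpair X psi w : K).
  by rewrite nrm_distC => h3; move: h1 h2 h3 jpsi; lra.
apply: ge_ereal_sup => _ [psi psi1 <-]; rewrite lee_fin.
apply/ler_addgt0Pr => e e0; have e20 : 0 < e / 2 by rewrite divr_gt0.
have [N wN] := cpair_approx w e20; have [M wM] := wc _ e20.
pose j := maxn N M.
have := wN j (leq_maxl _ _) psi psi1; have := wM j (leq_maxr _ _).
rewrite ler_norml => /andP[_ h1] h2.
have h3 := nrm_dist (cpair X psi w : K) (mpair psi (set_val w j)).
have h4 := mpair_le n0 (set_val w j) psi1.
by move: h1 h2 h3 h4; lra.
Qed.

Lemma wstar_mdual_hausdorff : hausdorff_space (wstar_mdual X).
Proof.
apply: wstar_hausdorff => f g fg; apply/val_inj/val_inj/funext => x.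
by have := fg (cst_ctensor (mtens x)); rewrite !cpair_cst.
Qed.

Lemma mpair_continuous u : continuous (fun psi : wstar_mdual X => mpair psi u : K^o).
Proof.
have := @wstar_continuous R k _ _ (cpair X) (cst_ctensor u).
rewrite (_ : (fun f : wstar_mdual X => cpair X f (cst_ctensor u)) =
  fun f => mpair f u)//.
by apply/funext => f; exact: cpair_cst.
Qed.

End CompletedTensor.

Section DualBall.
Variables (R : realType) (k : field_kind).
Local Notation K := (scalars R k).
Variable Y : completeNormedModType K.
Implicit Types (f : bdual Y) (y : Y).

Lemma bdual_linear f : linear (bdual_pair Y f).
Proof. by have [] := set_valP f. Qed.

Lemma bdual_pairZ f (c : K) y : bdual_pair Y f (c *: y) = c * bdual_pair Y f y.
Proof.
have D := linear_functionalD (@bdual_linear f).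
have f0 : bdual_pair Y f 0 = 0.
  by have /eqP := D 0 0; rewrite addr0 -subr_eq0 opprD addNKr oppr_eq0 => /eqP.
by have := @bdual_linear f c y 0; rewrite f0 !addr0.
Qed.

Lemma bdual_ball_le f y : bdual_ball Y f -> nrm (bdual_pair Y f y : K) <= nrm y.
Proof.
move=> f1; have [->|y0] := eqVneq y 0.
  by rewrite -(scale0r 0) bdual_pairZ mul0r !nrm0 scale0r nrm0.
pose c := of_real k (nrm y); have ny : 0 < nrm y by rewrite lt_neqAle nrm_ge0 eq_sym nrm_eq0 y0.
have c0 : c != 0 by rewrite /c -(nrm_eq0 c) nrm_of_real normr_eq0 gt_eqF.
have nc : nrm c = nrm y by rewrite nrm_of_real gtr0_norm.
rewrite -{1}(scale1r y) -(mulfV c0) -scalerA bdual_pairZ nrm_scalarM nc.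
rewrite -[leRHS]mulr1 ler_wpM2l ?nrm_ge0//.
rewrite -lee_fin (le_trans _ f1)//; apply: ereal_sup_ubound; exists (c^-1 *: y) => //=.
have : nrm (c *: (c^-1 *: y)) = nrm y by rewrite scalerA mulfV// scale1r.
rewrite nrmZ nc => /(canRL (mulKf (lt0r_neq0 ny))) ->.
by rewrite mulVf// gt_eqF.
Qed.

Lemma bdual_ball_of_linear (g : Y -> K^o) : linear g ->
  (forall y, nrm (g y : K) <= nrm y) ->
  exists2 f : bdual Y, bdual_ball Y f & forall y, bdual_pair Y f y = g y.
Proof.
move=> gl gy; have gD := linear_functionalD gl.
have gc : continuous g.
  move=> y; apply/cvg_nrmP => e e0.
  have : (id : Y -> Y) @ nbhs y --> y by exact: cvg_id.
  move/cvg_nrmP => /(_ e e0); apply: filterS => z; apply: le_lt_trans.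
  have -> : g y - g z = g (y - z).
    by apply/eqP; rewrite subr_eq -gD subrK.
  exact: gy.
exists (exist _ g (mem_set (conj gl gc))) => //.
apply: ge_ereal_sup => _ [y /= y1 <-]; rewrite lee_fin.
exact: le_trans (gy y) y1.
Qed.

Lemma bdual_ball_compact : compact (bdual_ball Y : set (wstar_dual Y)).
Proof.
apply: wstar_compact => [y|F FU l FB Fl].
  by exists (nrm y) => f; exact: bdual_ball_le.
have [|y|f f1 fl] := @bdual_ball_of_linear l; last by exists f.
- exact: (limit_linear (h := fun f y => bdual_pair Y f y) bdual_linear Fl).
- by apply: (limit_nrm_le FB _ (Fl y)) => f; exact: bdual_ball_le.
Qed.

Lemma bdual_ball_norming : norming (bdual_pair Y) (fun y => (nrm y)%:E) (bdual_ball Y).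
Proof.
have H y : exists2 f : bdual Y, bdual_ball Y f & nrm y <= nrm (bdual_pair Y f y : K).
  have [g [gl gy gy0]] := @hahn_banach_seminorm R k Y (fun y => nrm y) y (@nrmD R k Y) (@nrmZ R k Y).
  by have [f f1 fg] := bdual_ball_of_linear gl gy; exists f; rewrite // fg.
split; first by have [f f1 _] := H 0; exists f.
move=> y; apply/eqP; rewrite eq_le; apply/andP; split.
  have [f f1 fy] := H y; apply: (@le_trans _ _ (nrm (bdual_pair Y f y : K))%:E).
    by rewrite lee_fin.
  by apply: ereal_sup_ubound; exists f.
by apply: ge_ereal_sup => _ [f f1 <-]; rewrite lee_fin bdual_ball_le.
Qed.

Lemma wstar_dual_hausdorff : hausdorff_space (wstar_dual Y).
Proof. by apply: wstar_hausdorff => f g fg; apply/val_inj/funext => y; exact: fg. Qed.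

End DualBall.

(** * Hoelder inequality with three exponents *)

Section Exponents.
Variables (R : realType) (k : field_kind).
Local Notation K := (scalars R k).

Definition recip (s : \bar R) : R := fine (s^-1)%E.

Lemma recip_fin (s : R) : 1 <= s -> recip s%:E = s^-1.
Proof. by move=> s1; rewrite /recip inver gt_eqF// (lt_le_trans ltr01). Qed.

Lemma recip_y : recip +oo = 0.
Proof. by rewrite /recip invey. Qed.

Lemma recip_ge0 (s : \bar R) : (1 <= s)%E -> 0 <= recip s.
Proof.
case: s => [s||//]; last by rewrite recip_y.
by rewrite lee_fin => s1; rewrite recip_fin// invr_ge0 (le_trans ler01).
Qed.

(** Replaces a norm [l], possibly zero, by strictly larger numbers, by which one may divide. The
    proof enlarges [l] by [e / (c + 1)] because [c] may vanish. *)
Lemma le_of_forall_gt_mul (l c S : R) : 0 <= l -> 0 <= c ->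
  (forall L, l < L -> S <= L * c) -> S <= l * c.
Proof.
move=> l0 c0 H; apply/ler_addgt0Pr => e e0.
have e' : 0 < e / (c + 1) by rewrite divr_gt0// ltr_wpDl.
apply: le_trans (H (l + e / (c + 1)) _) _; first by rewrite ltrDl.
rewrite mulrDl lerD2l -[leRHS]mulr1 -mulrA ler_pM2l// mulrC ler_pdivrMr ?ltr_wpDl//.
by rewrite mul1r lerDl.
Qed.

(** The tangent inequality [y <= expR (y - 1)] at [y = x / A], raised to the power [rho]. It leads
    to Polya's proof of AM-GM below. *)
Lemma powR_le_exp (rho x A : R) : 0 <= rho -> 0 <= x -> 0 < A ->
  x `^ rho <= A `^ rho * expR (rho * (x / A - 1)).
Proof.
move=> rho0 x0 A0; move: x0; rewrite le_eqVlt => /predU1P[<-|x0].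
  have [->|rhoN0] := eqVneq rho 0; first by rewrite !powRr0 mul0r expR0 mulr1.
  by rewrite powR0// mulr_ge0 ?powR_ge0// expR_ge0.
have xA : 0 < x / A by rewrite divr_gt0.
have {1}-> : x = A * (x / A) by rewrite mulrC divfK// gt_eqF.
rewrite (powRM _ (ltW A0) (ltW xA)) ler_pM2l ?powR_gt0// /powR gt_eqF// ler_expR ler_wpM2l//.
by rewrite -ler_expR lnK ?posrE// (le_trans _ (expR_ge1Dx _))// addrC subrK.
Qed.

(** At [x = 0] some exponent is nonzero, since they sum to 1, and its factor vanishes. *)
Lemma powR_split3 (rho sigma tau x : R) : rho + sigma + tau = 1 -> 0 <= x ->
  x `^ rho * x `^ sigma * x `^ tau = x.
Proof.
move=> E; rewrite le_eqVlt => /predU1P[<-|x0]; last first.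
  have xN0 (a b : R) : (a + b == 0) ==> (x != 0) by rewrite (gt_eqF x0) implybT.
  by rewrite -(powRD (xN0 _ _)) -(powRD (xN0 _ _)) E powRr1// ltW.
have [r0|r0] := eqVneq rho 0; last by rewrite powR0// !mul0r.
have [s0|s0] := eqVneq sigma 0; last by rewrite (@powR0 _ sigma)// mulr0 mul0r.
have t1 : tau != 0 by move: E; rewrite r0 s0 !add0r => ->; exact: oner_neq0.
by rewrite (@powR0 _ tau)// mulr0.
Qed.

Lemma weighted_amgm3 (rho sigma tau x y z : R) :
  0 <= rho -> 0 <= sigma -> 0 <= tau -> rho + sigma + tau = 1 ->
  0 <= x -> 0 <= y -> 0 <= z ->
  x `^ rho * y `^ sigma * z `^ tau <= rho * x + sigma * y + tau * z.
Proof.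
move=> rho0 sigma0 tau0 E x0 y0 z0; apply/ler_addgt0Pr => e e0.
(* Lying strictly above the weighted mean [B], the base [A] is positive even if [B = 0], and the
   three exponents sum to [B / A - 1], which is at most 0. *)
set B := rho * x + sigma * y + tau * z; set A := B + e.
have B0 : 0 <= B by rewrite /B !addr_ge0// mulr_ge0.
have A0 : 0 < A by rewrite /A ltr_wpDl.
have h (c w : R) := @powR_le_exp c w A.
apply: (@le_trans _ _ ((A `^ rho * expR (rho * (x / A - 1))) *
   (A `^ sigma * expR (sigma * (y / A - 1))) * (A `^ tau * expR (tau * (z / A - 1))))).
  apply: ler_pM; rewrite ?mulr_ge0 ?powR_ge0// ?h//.
  by apply: ler_pM; rewrite ?mulr_ge0 ?powR_ge0// ?h//.
have -> : (A `^ rho * expR (rho * (x / A - 1))) *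
   (A `^ sigma * expR (sigma * (y / A - 1))) * (A `^ tau * expR (tau * (z / A - 1))) =
   (A `^ rho * A `^ sigma * A `^ tau) *
   (expR (rho * (x / A - 1)) * expR (sigma * (y / A - 1)) * expR (tau * (z / A - 1))) by ring.
rewrite (powR_split3 E (ltW A0)) -!expRD.
rewrite -[leRHS]mulr1 ler_pM2l// -[leRHS]expR0 ler_expR.
have -> : rho * (x / A - 1) + sigma * (y / A - 1) + tau * (z / A - 1) =
  B / A - (rho + sigma + tau) by rewrite /B; ring.
by rewrite E subr_le0 ler_pdivrMr// mul1r /A lerDl ltW.
Qed.

Section Lnorm.
Variable m : nat.
Implicit Types (u v : 'I_m -> K).

Lemma lnorm_fin (s : R) v : lnorm s%:E v = (\sum_(i < m) nrm (v i) `^ s) `^ s^-1.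
Proof. by []. Qed.

Lemma lnorm_y v : lnorm +oo v = \big[Order.max/0]_(i < m) nrm (v i).
Proof. by []. Qed.

Lemma lnorm_ge0 (s : \bar R) v : 0 <= lnorm s v.
Proof.
by case: s => [s||//]; [exact: powR_ge0|rewrite lnorm_y; exact: bigmax_ge_id].
Qed.

Lemma sum_powR_ge0 (s : R) v : 0 <= \sum_(i < m) nrm (v i) `^ s.
Proof. by apply: sumr_ge0 => i _; exact: powR_ge0. Qed.

Lemma lnorm_powR (s : R) v : 1 <= s -> lnorm s%:E v `^ s = \sum_(i < m) nrm (v i) `^ s.
Proof.
move=> s1; rewrite lnorm_fin -powRrM mulVf ?powRr1 ?sum_powR_ge0// gt_eqF//.
exact: lt_le_trans ltr01 s1.
Qed.

Lemma le_lnorm (s : \bar R) u v : (1 <= s)%E ->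
  (forall i, nrm (u i) <= nrm (v i)) -> lnorm s u <= lnorm s v.
Proof.
case: s => [s|_ uv|//]; last first.
  by rewrite !lnorm_y; apply: le_bigmax2 => i _.
rewrite lee_fin => s1 uv; have s0 : 0 <= s by exact: le_trans ler01 s1.
rewrite !lnorm_fin ge0_ler_powR ?nnegrE ?invr_ge0 ?sum_powR_ge0//.
by apply: ler_sum => i _; rewrite ge0_ler_powR ?nnegrE ?nrm_ge0.
Qed.

Lemma lnorm_scale (s : \bar R) (c : K) v : (1 <= s)%E ->
  lnorm s (fun i => c * v i) = nrm c * lnorm s v.
Proof.
case: s => [s|_|//]; last first.
  rewrite !lnorm_y; under eq_bigr do rewrite nrm_scalarM.
  rewrite (big_morph (fun x : R => nrm c * x) (id1 := 0) (op1 := Order.max)) ?mulr0//.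
  by move=> x y; rewrite maxr_pMr// nrm_ge0.
rewrite lee_fin => s1; have s0 : 0 < s by exact: lt_le_trans ltr01 s1.
rewrite !lnorm_fin; under eq_bigr do rewrite nrm_scalarM powRM ?nrm_ge0//.
rewrite -mulr_sumr powRM ?powR_ge0 ?sum_powR_ge0// -powRrM mulfV ?powRr1 ?nrm_ge0//.
by rewrite gt_eqF.
Qed.

(* Normalising each factor this way turns Hoelder's inequality, endpoint
   exponents included, into the weighted AM-GM inequality: for [s = +oo] the
   weights [x i] are [0] and [0 `^ 0 = 1]. *)
Lemma lnorm_factor (s : \bar R) v (M : R) : (1 <= s)%E -> lnorm s v < M ->
  exists x : 'I_m -> R, [/\ forall i, 0 <= x i, \sum_(i < m) x i <= 1 &
    forall i, nrm (v i) <= M * x i `^ recip s].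
Proof.
move=> s1 vM; have M0 : 0 < M by exact: le_lt_trans (lnorm_ge0 s v) vM.
case: s s1 vM => [s|_|//]; last first.
  rewrite lnorm_y => vM; exists (fun=> 0); split=> // [|i].
    by rewrite big1// ler01.
  rewrite recip_y powRr0 mulr1; apply: le_trans (ltW vM).
  exact: (le_bigmax_cond _ (fun i => nrm (v i))).
rewrite lee_fin => s1 vM; have s0 : 0 < s by exact: lt_le_trans ltr01 s1.
exists (fun i => (nrm (v i) / M) `^ s); split=> [i||i].
- exact: powR_ge0.
- have M0' : 0 <= M^-1 by rewrite invr_ge0 ltW.
  have one_s : 1 `^ s = 1 :> R by rewrite powR1.
  under eq_bigr do rewrite (powRM _ (nrm_ge0 _) M0').
  rewrite -mulr_suml -lnorm_powR// -(powRM _ (lnorm_ge0 _ _) M0').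
  rewrite -[leRHS]one_s ge0_ler_powR ?nnegrE//; first exact: ltW.
    by rewrite mulr_ge0// lnorm_ge0.
  by rewrite ler_pdivrMr// mul1r ltW.
- have vM0 : 0 <= nrm (v i) / M by rewrite divr_ge0 ?nrm_ge0 ?(ltW M0).
  rewrite recip_fin// -powRrM mulfV ?gt_eqF// powRr1//.
  by rewrite mulrC divfK// gt_eqF.
Qed.

Lemma hoelder3 (r s t : \bar R) (u v w : 'I_m -> K) :
  (1 <= r)%E -> (1 <= s)%E -> (1 <= t)%E -> recip r + recip s + recip t = 1 ->
  \sum_(i < m) nrm (u i) * nrm (v i) * nrm (w i) <= lnorm r u * lnorm s v * lnorm t w.
Proof.
move=> r1 s1 t1 E; set S := \sum_(i < m) _.
rewrite -mulrA; apply: le_of_forall_gt_mul => [||L uL]; rewrite ?mulr_ge0 ?lnorm_ge0//.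
rewrite mulrCA; apply: le_of_forall_gt_mul => [||M vM]; rewrite ?mulr_ge0 ?lnorm_ge0//.
  exact: le_trans (lnorm_ge0 r u) (ltW uL).
have L0 : 0 <= L by exact: le_trans (lnorm_ge0 r u) (ltW uL).
have M0 : 0 <= M by exact: le_trans (lnorm_ge0 s v) (ltW vM).
rewrite mulrA mulrC; apply: le_of_forall_gt_mul => [||N wN].
- exact: lnorm_ge0.
- exact: mulr_ge0.
have N0 : 0 <= N by exact: le_trans (lnorm_ge0 t w) (ltW wN).
have [x [x0 x1 ux]] := lnorm_factor r1 uL.
have [y [y0 y1 vy]] := lnorm_factor s1 vM.
have [z [z0 z1 wz]] := lnorm_factor t1 wN.
have r0 := recip_ge0 r1; have s0 := recip_ge0 s1; have t0 := recip_ge0 t1.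
apply: (@le_trans _ _ (\sum_(i < m) (N * (M * L)) *
   (recip r * x i + recip s * y i + recip t * z i))).
  apply: ler_sum => i _.
  apply: (@le_trans _ _ ((L * x i `^ recip r) * (M * y i `^ recip s) * (N * z i `^ recip t))).
    apply: ler_pM; rewrite ?mulr_ge0 ?nrm_ge0//.
    by apply: ler_pM; rewrite ?mulr_ge0 ?nrm_ge0.
  have -> : L * x i `^ recip r * (M * y i `^ recip s) * (N * z i `^ recip t) =
    (N * (M * L)) * (x i `^ recip r * y i `^ recip s * z i `^ recip t) by ring.
  by rewrite ler_wpM2l ?mulr_ge0// weighted_amgm3.
rewrite -mulr_sumr -[leRHS]mulr1 ler_wpM2l ?mulr_ge0// !big_split/= -!mulr_sumr -E.
by rewrite !lerD// -[leRHS]mulr1 ler_wpM2l.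
Qed.

End Lnorm.

(** Weighted AM-GM with weights [s^-1], [1 - s^-1] and 0; the third factor is zero to the power
    zero, hence 1. *)
Lemma young_powR (s a b : R) : 1 <= s -> 0 <= a -> 0 <= b ->
  a `^ (s - 1) * b <= s^-1 * b `^ s + (1 - s^-1) * a `^ s.
Proof.
move=> s1 a0 b0; have s0 : 0 < s by exact: lt_le_trans ltr01 s1.
have sV : s * s^-1 = 1 by rewrite mulfV// gt_eqF.
have : (b `^ s) `^ s^-1 * (a `^ s) `^ (1 - s^-1) * 0 `^ 0 <=
    s^-1 * b `^ s + (1 - s^-1) * a `^ s + 0 * 0.
  apply: weighted_amgm3; rewrite ?powR_ge0//.
  - by rewrite invr_ge0 ltW.
  - by rewrite subr_ge0 invf_le1.
  - by rewrite addr0 addrC subrK.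
rewrite powRr0 mulr1 mul0r addr0 -!powRrM sV (powRr1 b0) mulrC.
by rewrite (_ : s * (1 - s^-1) = s - 1)// mulrBr mulr1 sV.
Qed.

End Exponents.

(** * Domination by integrals *)

Lemma continuous_bounded (R : realType) (T : topologicalType) (f : T -> R) :
  compact [set: T] -> continuous f -> exists M : R, forall x, `|f x| <= M.
Proof.
move=> cT cf; have : compact (f @` setT).
  by apply: continuous_compact => //; exact: continuous_subspaceT.
move=> /compact_bounded[M [_ /(_ (M + 1))]].
rewrite ltrDl ltr01 => /(_ isT) fM; exists (M + 1) => x.
by apply: fM; exists x.
Qed.

Section Domination.
Variables (R : realType) (A B : ptopologicalType) (J : Type).
Variables (g : J -> A -> R) (h : J -> B -> R) (z : J -> R).
Hypotheses (cptA : compact [set: A]) (hausA : hausdorff_space A)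
  (cptB : compact [set: B]) (hausB : hausdorff_space B).
Hypotheses (cg : forall j, continuous (g j)) (ch : forall j, continuous (h j)).
Hypotheses (g0 : forall j x, 0 <= g j x) (h0 : forall j y, 0 <= h j y).

(** An abstract Pietsch domination theorem: in the hypothesis the points [x] and [y] depend on the
    combination [l], in the conclusion the measures serve all [j] at once. Nonnegativity of [c],
    [sigma] and [tau] allows both means to be replaced by the larger integrals. *)
Theorem domination_of_sums (c rho sigma tau : R) :
  0 <= c -> 0 <= sigma -> 0 <= tau ->
  (forall l : seq (R * J), all (fun u => 0 <= u.1) l ->
    forall e : R, 0 < e -> exists x y,
      \sum_(u <- l) u.1 * z u.2 <= c * (rho * \sum_(u <- l) u.1 +
        sigma * \sum_(u <- l) u.1 * g u.2 x +
        tau * \sum_(u <- l) u.1 * h u.2 y) + e) ->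
  exists (mu : probability (borel_of A) R) (nu : probability (borel_of B) R),
    [/\ regular_measure mu, regular_measure nu & forall j,
      ((z j)%:E <= c%:E * (rho%:E + sigma%:E * \int[mu]_x (g j x)%:E
                           + tau%:E * \int[nu]_y (h j y)%:E))%E].
Proof.
move=> c0 sigma0 tau0 sums.
have [Mg gM] := choice (fun j => continuous_bounded cptA (@cg j)).
have [Mh hM] := choice (fun j => continuous_bounded cptB (@ch j)).
have norm1 (s : A * B) : `|1 : R| <= 1 by rewrite normr1.
pose one : bfun R (A * B) := @mk_bfun R (A * B) (fun=> 1) 1 norm1.
pose G j : bfun R (A * B) := @mk_bfun R (A * B) (fun s => g j s.1) (Mg j) (fun s => gM j s.1).
pose H j : bfun R (A * B) := @mk_bfun R (A * B) (fun s => h j s.2) (Mh j) (fun s => hM j s.2).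
pose F j := (c * rho) *: one + (c * sigma) *: G j + (c * tau) *: H j - z j *: one.
pose Q := [set \sum_(u <- l) u.1 *: F u.2 |
            l in [set l : seq (R * J) | all (fun u => 0 <= u.1) l]].
have FE j s : (F j s : R) = c * (rho + sigma * g j s.1 + tau * h j s.2) - z j.
  have : (c * rho) * 1 + (c * sigma) * g j s.1 + (c * tau) * h j s.2 - z j * 1
    = c * (rho + sigma * g j s.1 + tau * h j s.2) - z j by ring.
  by [].
have sumE (l : seq (R * J)) s :
    ((\sum_(u <- l) u.1 *: F u.2) s : R) = \sum_(u <- l) u.1 * (F u.2 s : R).
  by elim/big_rec2: _ => //= u _ x _ <-.
have [||||L [Lmean LQ]] := @mean_on_cone R (A * B) (point, point) Q.
- by exists [::] => //; rewrite big_nil.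
- move=> _ _ [l l0 <-] [k k0 <-]; exists (l ++ k); last by rewrite big_cat.
  by rewrite /= all_cat l0 k0.
- move=> t _ t0 [l l0 <-]; exists [seq (t * u.1, u.2) | u <- l].
    rewrite /= all_map; apply: sub_all l0 => u /= u0; exact: mulr_ge0.
  by rewrite big_map scaler_sumr; apply: eq_bigr => u _; rewrite scalerA.
- move=> _ [l l0 <-] e e0; have [x [y xy]] := sums l l0 e e0.
  exists (x, y); rewrite sumE (eq_bigr (fun u => c * (rho * u.1 +
      sigma * (u.1 * g u.2 x) + tau * (u.1 * h u.2 y)) - u.1 * z u.2)); last first.
    by move=> u _; rewrite FE/=; ring.
  rewrite sumrB -mulr_sumr !big_split/= -!mulr_sumr.
  by rewrite lerBrDr [leLHS]addrC lerBlDr.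
have [mu [rmu muL]] := @mean_representation R A (A * B) fst L Lmean cptA hausA.
have [nu [rnu nuL]] := @mean_representation R B (A * B) snd L Lmean cptB hausB.
exists mu, nu; split=> // j.
have LF : 0 <= (L (F j) : R).
  by apply: LQ; exists [:: (1, j)]; rewrite /= ?ler01 ?big_seq1 ?scale1r.
have L1 : (L one : R) = 1 by exact: mean_cst.
have zL : z j <= c * (rho + sigma * (L (G j) : R) + tau * (L (H j) : R)).
  move: LF; rewrite /F linearB !linearD/= !linearZ/= !L1.
  rewrite -[in X in _ -> X]subr_ge0 => LF; apply: le_trans LF _.
  by rewrite le_eqVlt; apply/orP; left; apply/eqP; rewrite /GRing.scale/=; ring.
apply: (@le_trans _ _ (c * (rho + sigma * (L (G j) : R) + tau * (L (H j) : R)))%:E).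
  by rewrite lee_fin.
rewrite EFinM !EFinD !EFinM lee_wpmul2l ?lee_fin// leeD//; last first.
  rewrite lee_wpmul2l ?lee_fin//; exact: (nuL (h j) (H j)).
rewrite leeD2l// lee_wpmul2l ?lee_fin//; exact: (muL (g j) (G j)).
Qed.

End Domination.

(** Where [g] is positive the power is differentiable; where [g] vanishes the radius [e] to the
    power [r^-1] answers [e]. *)
Lemma continuous_powR (R : realType) (T : topologicalType) (g : T -> R) (r : R) :
  0 < r -> (forall t, 0 <= g t) -> continuous g -> continuous (fun t => g t `^ r).
Proof.
move=> r0 g0 cg t; have := g0 t; rewrite le_eqVlt => /predU1P[gt0|gt0].
  apply/cvgrPdist_lt => e e0; rewrite -gt0 powR0 ?gt_eqF//.
  have d0 : 0 < e `^ r^-1 by exact: powR_gt0.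
  move/cvgrPdist_lt : (cg t) => /(_ _ d0); apply: filterS => u.
  rewrite -gt0 !sub0r !normrN !ger0_norm ?powR_ge0// => gu.
  have -> : e = (e `^ r^-1) `^ r by rewrite -powRrM mulVf ?powRr1 ?(ltW e0)// gt_eqF.
  by rewrite gt0_ltr_powR ?nnegrE ?powR_ge0.
have dg : derivable (fun x : R => x `^ r) (g t) 1.
  by apply: derivable_powR; rewrite in_itv/= gt0.
apply: (@continuous_comp T R R g (fun x : R => x `^ r)); first exact: cg.
by apply: differentiable_continuous; apply/derivable1_diffP.
Qed.

(** * Weak norms and integral norms over a norming set *)

Section NormingPair.
Variables (R : realType) (k : field_kind).
Local Notation K := (scalars R k).
Variables (V : lmodType K) (N : V -> R) (B : Type) (Bs : set B).
Variables (pb : B -> V -> K) (T : ptopologicalType) (iota : T -> B).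
Hypotheses (N0 : forall v, 0 <= N v) (NZ : forall c v, N (c *: v) = nrm c * N v).
Hypothesis pb_lin : forall b c u v, pb b (c *: u + v) = c * pb b u + pb b v.
Hypothesis pb_le : forall b v, Bs b -> nrm (pb b v) <= N v.
Hypothesis iotaB : forall t, Bs (iota t).
Hypothesis pb_cont : forall v, continuous (fun t => pb (iota t) v : K^o).
Hypothesis pb_norming : forall v (e : R), 0 < e ->
  exists t, N v - e <= nrm (pb (iota t) v).

Let pb0 b : pb b 0 = 0.
Proof.
have := pb_lin b 1 0 0; rewrite scaler0 addr0 mul1r => /eqP.
by rewrite -subr_eq0 opprD addNKr oppr_eq0 => /eqP.
Qed.

Let pbD b u v : pb b (u + v) = pb b u + pb b v.
Proof. by have := pb_lin b 1 u v; rewrite scale1r mul1r. Qed.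

Let pbZ b c v : pb b (c *: v) = c * pb b v.
Proof. by have := pb_lin b c v 0; rewrite !addr0 pb0 addr0. Qed.

(** Both weak norms are instances. [Bs] plays the full dual ball, over which the supremum runs,
    while [iota] parametrises the norming set by the space [T] that carries the measure. *)
Definition weak_sup (s : \bar R) (m : nat) (v : 'I_m -> V) : \bar R :=
  ereal_sup [set (lnorm s (fun i => pb b (v i)))%:E | b in Bs].

Definition pow_pair (s : \bar R) (v : V) (t : T) : R :=
  match s with r%:E => nrm (pb (iota t) v) `^ r | _ => 0 end.

Definition admissible (s : \bar R) (v : V) : Prop :=
  match s with r%:E => True | _ => N v <= 1 end.

Lemma nrm_pair_continuous v : continuous (fun t => nrm (pb (iota t) v)).
Proof.
move=> t; apply/cvgrPdist_lt => e e0.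
move/(cvg_nrmP _ (fun t => pb (iota t) v : K^o) _) : (@pb_cont v t) => /(_ e e0).
by apply: filterS => u; apply: le_lt_trans; exact: nrm_dist_norm.
Qed.

Lemma pow_pair_ge0 s v t : 0 <= pow_pair s v t.
Proof. by case: s => //= s; exact: powR_ge0. Qed.

Lemma pow_pair_continuous s v : (1 <= s)%E -> continuous (pow_pair s v).
Proof.
case: s => [s||//]; last by move=> _ t; exact: cvg_cst.
rewrite lee_fin => s1; apply: continuous_powR => [|t|].
- exact: lt_le_trans ltr01 s1.
- exact: nrm_ge0.
- exact: nrm_pair_continuous.
Qed.

Lemma weak_sup_ub s m (v : 'I_m -> V) b : Bs b ->
  ((lnorm s (fun i => pb b (v i)))%:E <= weak_sup s v)%E.
Proof. by move=> Bb; apply: ereal_sup_ubound; exists b. Qed.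

Lemma weak_sup_fin s m (v : 'I_m -> V) : (1 <= s)%E ->
  exists2 W : R, 0 <= W & weak_sup s v = W%:E.
Proof.
move=> s1; have W0 : (0 <= weak_sup s v)%E.
  apply: le_trans (weak_sup_ub s v (iotaB point)); rewrite lee_fin.
  exact: lnorm_ge0.
have Wfin : (weak_sup s v < +oo)%E.
  apply: (@le_lt_trans _ _ (lnorm s (fun i => of_real k (N (v i))))%:E); last exact: ltry.
  apply: ge_ereal_sup => _ [b Bb <-]; rewrite lee_fin le_lnorm// => i.
  by rewrite nrm_of_real ger0_norm// pb_le.
exists (fine (weak_sup s v)); first exact: fine_ge0.
by rewrite fineK// ge0_fin_numE.
Qed.

Lemma powR_predM (s x : R) : 1 <= s -> 0 <= x -> x `^ (s - 1) * x = x `^ s.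
Proof.
move=> s1; rewrite le_eqVlt => /predU1P[<-|x0].
  by rewrite mulr0 powR0// gt_eqF// (lt_le_trans ltr01).
rewrite -[X in _ * X]powRr1 ?(ltW x0)// -powRD ?subrK//.
by rewrite (gt_eqF x0) implybT.
Qed.

(* Testing the norming set on [\sum_i |z i|^(s-1) sgn(z i)^* v i], where
   [z i = b(v i)], and Young's inequality: the weak [l^s]-norm, a supremum over
   the whole dual ball, may be computed on the norming set. *)
Lemma sum_powR_norming (s : R) m (v : 'I_m -> V) b (e : R) :
  1 <= s -> Bs b -> 0 < e -> exists t,
  \sum_(i < m) nrm (pb b (v i)) `^ s <= \sum_(i < m) nrm (pb (iota t) (v i)) `^ s + e.
Proof.
move=> s1 Bb e0; have s0 : 0 < s by exact: lt_le_trans ltr01 s1.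
pose z i := nrm (pb b (v i)).
have /choice[c cE] : forall i, exists c : K, nrm c = 1 /\ c * pb b (v i) = of_real k (z i).
  by move=> i; have [c ? ?] := unimodularP (pb b (v i)); exists c.
pose x := \sum_(i < m) (of_real k (z i `^ (s - 1)) * c i) *: v i.
have pbx b' : pb b' x = \sum_(i < m) (of_real k (z i `^ (s - 1)) * c i) * pb b' (v i).
  by rewrite /x (big_morph _ (pbD b') (pb0 b')); apply: eq_bigr => i _; exact: pbZ.
pose S := \sum_(i < m) z i `^ s.
have S0 : 0 <= S by apply: sumr_ge0 => i _; exact: powR_ge0.
have xS : S <= N x.
  apply: le_trans (pb_le x Bb); rewrite pbx.
  rewrite (eq_bigr (fun i => of_real k (z i `^ s))); last first.
    move=> i _; have [_ ci] := cE i; rewrite -mulrA ci -of_realM powR_predM//.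
    exact: nrm_ge0.
  rewrite -(big_morph _ (@of_realD R k) (@of_real0 R k)) nrm_of_real.
  exact: ler_norm.
(* Absorbing [(1 - s^-1) * S] into the left side multiplies the error by [s]. *)
have es0 : 0 < e / s by rewrite divr_gt0.
have [t tx] := pb_norming x es0; exists t.
pose T' := \sum_(i < m) nrm (pb (iota t) (v i)) `^ s.
suff : S <= T' + e by [].
have xT : nrm (pb (iota t) x) <= s^-1 * T' + (1 - s^-1) * S.
  rewrite pbx; apply: le_trans (nrm_sum _ _) _.
  rewrite /T' /S !mulr_sumr -big_split/=; apply: ler_sum => i _.
  have [ci _] := cE i.
  rewrite !nrm_scalarM ci mulr1 nrm_of_real ger0_norm ?powR_ge0//.
  by apply: young_powR; rewrite ?nrm_ge0.
have : S - e / s <= s^-1 * T' + (1 - s^-1) * S.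
  by apply: le_trans xT; apply: le_trans tx; rewrite lerD2r.
have sS : s * (s^-1 * S) = S by rewrite mulVKf// gt_eqF.
rewrite -(ler_pM2l s0) mulrBr mulrDr (mulrC e) mulVKf ?gt_eqF// mulVKf ?gt_eqF//.
by rewrite mulrA mulrBr mulr1 mulfV ?gt_eqF// mulrBl mul1r; lra.
Qed.

(** For finite [s] the witness is the weak norm of the weighted family to the power [s]: the factors
    [w^(1/s)] turn this power into a sum with weights [w i]. For infinite [s] it is 0, and
    admissibility bounds the weak norm by 1. Of the error [e], one half pays for approaching the
    supremum over the ball, the other for passing to the norming set. *)
Lemma weak_sup_weighted (s : \bar R) m (w : 'I_m -> R) (v : 'I_m -> V) :
  (1 <= s)%E -> (forall i, 0 <= w i) -> (forall i, admissible s (v i)) ->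
  exists S : R, [/\ 0 <= S,
    forall e, 0 < e -> exists t, S <= \sum_(i < m) w i * pow_pair s (v i) t + e &
    (weak_sup s (fun i => of_real k (w i `^ recip s) *: v i) <= (S `^ recip s)%:E)%E].
Proof.
move=> s1 w0 va; case: s s1 va => [s s1 _|_ va|//]; last first.
  exists 0; split=> // [e e0|].
    by exists point; rewrite big1 ?add0r ?(ltW e0)// => i _; rewrite mulr0.
  rewrite recip_y powRr0; apply: ge_ereal_sup => _ [b Bb <-].
  rewrite lee_fin lnorm_y; apply: bigmax_le => // i _.
  by rewrite powRr0 of_real1 scale1r (le_trans (pb_le _ Bb))//; exact: va.
have [W W0 WE] := weak_sup_fin (fun i => of_real k (w i `^ recip s%:E) *: v i) s1.
rewrite lee_fin in s1; have s0 : 0 < s by exact: lt_le_trans ltr01 s1.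
have wE i b : nrm (pb b (of_real k (w i `^ recip s%:E) *: v i)) `^ s =
    w i * nrm (pb b (v i)) `^ s.
  rewrite pbZ nrm_scalarM nrm_of_real ger0_norm ?powR_ge0// powRM ?powR_ge0 ?nrm_ge0//.
  by rewrite -powRrM recip_fin// mulVf ?gt_eqF// powRr1.
exists (W `^ s); split; first exact: powR_ge0.
- move=> e e0; have e20 : 0 < e / 2 by rewrite divr_gt0.
  (* Below [W] this is continuity of the power, above [W] monotonicity. The absolute value keeps the
     base nonnegative when [W - d] is negative. *)
  have [d [d0 Wd]] : exists d : R, 0 < d /\ forall y, W - d < y -> W `^ s <= `|y| `^ s + e / 2.
    have : continuous (fun y : R => `|y| `^ s).
      by apply: continuous_powR => //; exact: norm_continuous.
    move=> /(_ W)/cvgrPdist_lt/(_ _ e20)/nbhs_ballP[d /= d0 Wd].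
    exists d; split=> // y Wy; rewrite -(ger0_norm W0).
    have [yW|/ltW Wy'] := leP W y; last first.
      have /Wd : ball W d y by rewrite /ball/= ltr_distlC; apply/andP; split; lra.
      by rewrite ltr_norml => /andP[_]; lra.
    rewrite (@le_trans _ _ (`|y| `^ s))//; last by rewrite lerDl ltW.
    by rewrite ge0_ler_powR ?nnegrE ?(ltW s0)// !ger0_norm// (le_trans W0).
  have [|_ [b Bb <-]] := @ub_ereal_sup_adherent _
     [set (lnorm s%:E (fun i => pb b (of_real k (w i `^ recip s%:E) *: v i)))%:E | b in Bs]
     d d0 _.
    by rewrite -/(weak_sup _ _) WE.
  rewrite -/(weak_sup _ _) WE -EFinB lte_fin => /Wd.
  rewrite ger0_norm ?lnorm_ge0// lnorm_powR// => Wb.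
  have [t bt] := sum_powR_norming (fun i => of_real k (w i `^ recip s%:E) *: v i) s1 Bb e20.
  exists t; rewrite (eq_bigr (fun i =>
      nrm (pb (iota t) (of_real k (w i `^ recip s%:E) *: v i)) `^ s)).
    by move: Wb bt; lra.
  by move=> i _; rewrite wE.
- by rewrite WE recip_fin// -powRrM mulfV ?gt_eqF// powRr1.
Qed.

Variable mu : probability (borel_of T) R.

(** One factor of the domination inequality. At an infinite exponent it is [N] itself, as the
    convention for [q = 1] and [p = 1] prescribes, and not an essential supremum. *)
Definition side_norm (s : \bar R) (v : V) : R :=
  match s with
  | r%:E => fine (\int[mu]_t (nrm (pb (iota t) v) `^ r)%:E) `^ r^-1
  | _ => N v
  end.

Lemma side_norm_ge0 s v : 0 <= side_norm s v.
Proof. by case: s => [s||] /=; rewrite ?powR_ge0. Qed.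

Lemma measurable_pow_pair (s : R) v : 1 <= s ->
  measurable_fun setT ((fun t => (nrm (pb (iota t) v) `^ s)%:E) : borel_of T -> \bar R).
Proof.
move=> s1; apply/measurable_EFinP; apply: continuous_borel_measurable.
exact: (@pow_pair_continuous s%:E v s1).
Qed.

Lemma integral_pow_le (s : R) (f : T -> R) (M : R) : 
  measurable_fun setT ((fun t => (f t)%:E) : borel_of T -> \bar R) ->
  0 <= M -> (forall t, 0 <= f t <= M) -> (\int[mu]_t (f t)%:E <= M%:E)%E.
Proof.
move=> mf M0 fM; apply: (@le_trans _ _ (\int[mu]_t (cst M%:E t))%E).
  apply: ge0_le_integral => //.
  - by move=> t _; rewrite lee_fin; have /andP[] := fM t.
  - by move=> t _; rewrite lee_fin; have /andP[] := fM t.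
have mu1 : mu setT = 1%E by exact: probability_setT.
by rewrite integral_cst//; rewrite [X in (_ * X)%E]mu1 mule1.
Qed.

Lemma integral_pow_fin (s : R) v : 1 <= s ->
  (\int[mu]_t (nrm (pb (iota t) v) `^ s)%:E)%E =
  (fine (\int[mu]_t (nrm (pb (iota t) v) `^ s)%:E))%:E.
Proof.
move=> s1; rewrite fineK// ge0_fin_numE; last first.
  by apply: integral_ge0 => t _; rewrite lee_fin powR_ge0.
apply: (@le_lt_trans _ _ (N v `^ s)%:E); last exact: ltry.
apply: integral_pow_le => //; first exact: measurable_pow_pair.
  exact: powR_ge0.
move=> t; rewrite powR_ge0/= ge0_ler_powR ?nnegrE ?nrm_ge0//.
- exact: le_trans ler01 s1.
- exact: pb_le.
Qed.

Lemma side_normE (s : R) v : 1 <= s ->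
  'N[mu]_(s%:E)[(fun t => (nrm (pb (iota t) v))%:E)]%E = (side_norm s%:E v)%:E.
Proof.
move=> s1; rewrite unlock /Lnorm /side_norm -poweR_EFin -integral_pow_fin//.
congr (_ `^ _)%E; apply: eq_integral => t _.
by rewrite abse_EFin ger0_norm ?nrm_ge0.
Qed.

(** For finite [s] the sum of the integrals is the integral of a sum bounded pointwise by the weak
    norm to the power [s], and [mu] has mass one. For infinite [s] the norming property bounds each
    [N (v i)]. *)
Lemma lnorm_side_norm_le s m (v : 'I_m -> V) : (1 <= s)%E ->
  ((lnorm s (fun i => of_real k (side_norm s (v i))))%:E <= weak_sup s v)%E.
Proof.
move=> s1; have [W W0 WE] := weak_sup_fin v s1; rewrite WE lee_fin.
have WB t : lnorm s (fun i => pb (iota t) (v i)) <= W.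
  by rewrite -lee_fin -WE; exact: weak_sup_ub.
case: s s1 WE WB => [s s1 WE WB|_ WE WB|//]; last first.
  rewrite lnorm_y; apply: bigmax_le => // i _.
  rewrite nrm_of_real ger0_norm//=; apply/ler_addgt0Pr => e e0.
  have [t tv] := pb_norming (v i) e0.
  rewrite -lerBlDr (le_trans tv)// (le_trans _ (WB t))// lnorm_y.
  exact: (le_bigmax_cond _ (fun i => nrm (pb (iota t) (v i)))).
rewrite lee_fin in s1; have s0 : 0 < s by exact: lt_le_trans ltr01 s1.
have Ws : (W `^ s) `^ s^-1 = W by rewrite -powRrM mulfV ?gt_eqF// powRr1.
rewrite lnorm_fin -[leRHS]Ws ge0_ler_powR ?nnegrE ?invr_ge0 ?(ltW s0) ?sum_powR_ge0 ?powR_ge0//.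
rewrite -lee_fin -sumEFin (eq_bigr (fun i =>
    \int[mu]_t (nrm (pb (iota t) (v i)) `^ s)%:E)%E); last first.
  move=> i _; rewrite integral_pow_fin// nrm_of_real ger0_norm ?side_norm_ge0//.
  rewrite /side_norm -powRrM mulVf ?gt_eqF// powRr1//.
  by apply: fine_ge0; apply: integral_ge0 => t _; rewrite lee_fin powR_ge0.
rewrite -ge0_integral_sum//; last 2 first.
- by move=> i; exact: measurable_pow_pair.
- by move=> i t _; rewrite lee_fin powR_ge0.
under eq_integral do rewrite sumEFin.
apply: integral_pow_le => //.
- rewrite (_ : (fun t => _) = fun t =>
      (\sum_(i < m) (nrm (pb (iota t) (v i)) `^ s)%:E)%E); last first.
    by apply/funext => t; rewrite sumEFin.
  by apply: emeasurable_sum => i; exact: measurable_pow_pair.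
- exact: powR_ge0.
move=> t; rewrite sum_powR_ge0/= -lnorm_powR// ge0_ler_powR ?nnegrE ?(ltW s0) ?lnorm_ge0//.
Qed.

(** The factor [recip s] gives every exponent, infinite ones included, a bound of the same shape;
    the bounds of the two sides and [recip r] then add up to 1. *)
Lemma normalise_side_norm s v (M : R) : (1 <= s)%E -> side_norm s v < M ->
  admissible s (of_real k M^-1 *: v) /\
  ((recip s)%:E * \int[mu]_t (pow_pair s (of_real k M^-1 *: v) t)%:E <= (recip s)%:E)%E.
Proof.
move=> s1 vM; have M0 : 0 < M by exact: le_lt_trans (side_norm_ge0 s v) vM.
have MV0 : 0 <= M^-1 by rewrite invr_ge0 ltW.
case: s s1 vM => [s s1 /= vM|_ /= vM|//]; last first.
  rewrite recip_y mul0e; split=> //.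
  by rewrite NZ nrm_of_real ger0_norm// mulrC ler_pdivrMr// mul1r ltW.
split=> //; rewrite -[leRHS]mule1 lee_wpmul2l ?lee_fin ?recip_ge0//.
rewrite lee_fin in s1; have s0 : 0 < s by exact: lt_le_trans ltr01 s1.
rewrite (eq_integral (fun t : borel_of T =>
    (M^-1 `^ s)%:E * (nrm (pb (iota t) v) `^ s)%:E)%E); last first.
  by move=> t _; rewrite /pow_pair pbZ nrm_scalarM nrm_of_real ger0_norm// powRM ?nrm_ge0//.
rewrite ge0_integralZl//=; last 3 first.
- exact: measurable_pow_pair.
- by move=> t _; rewrite lee_fin powR_ge0.
- by rewrite lee_fin powR_ge0.
rewrite integral_pow_fin// -EFinM lee_fin; set I := fine _ in vM *.
have I0 : 0 <= I.
  by apply: fine_ge0; apply: integral_ge0 => t _; rewrite lee_fin powR_ge0.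
have -> : I = (I `^ s^-1) `^ s by rewrite -powRrM mulVf ?gt_eqF// powRr1.
have -> : (1 : R) = (M^-1 * M) `^ s by rewrite mulVf ?gt_eqF// powR1.
rewrite -powRM ?powR_ge0// ge0_ler_powR ?nnegrE ?mulr_ge0 ?powR_ge0 ?(ltW s0) ?(ltW M0)//.
by rewrite ler_wpM2l// ltW.
Qed.

End NormingPair.

(** * Functionals on the Lapreste tensor product *)

Section Laprest.
Variables (R : realType) (k : field_kind) (p q : \bar R).
Local Notation K := (scalars R k).
Local Notation "p ^*" := (hoelder_conjugate p) : ereal_scope.
Hypotheses (hp : (1 <= p)%E) (hq : (1 <= q)%E) (hpq : (1 <= p^-1 + q^-1)%E).
Variables (n : nat) (n0 : (0 < n)%N).
Variables (X : 'I_n -> completeNormedModType K) (Y : completeNormedModType K).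
Variable zeta : {scalar tensorY X Y}.
Implicit Types (a b : mtensor X) (y : Y).

Local Notation r := (lapreste_index p q).
Local Notation s := (q^*)%E.
Local Notation t := (p^*)%E.

Lemma recipE (e : \bar R) : (1 <= e)%E -> (e^-1)%E = (recip e)%:E.
Proof.
case: e => [e||//]; last by rewrite recip_y invey.
by rewrite lee_fin => e1; rewrite recip_fin// inver gt_eqF// (lt_le_trans ltr01).
Qed.

Let r1 : (1 <= r)%E. Proof. by have [] := lapreste_indexP hp hq hpq. Qed.
Let s1 : (1 <= s)%E. Proof. exact: hoelder_conj_ge1. Qed.
Let t1 : (1 <= t)%E. Proof. exact: hoelder_conj_ge1. Qed.

Let recip_sum : recip r + recip s + recip t = 1.
Proof.
have [_] := lapreste_indexP hp hq hpq.
by rewrite !recipE// -!EFinD => -[].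
Qed.

Lemma tensY0l y : tensY (0 : mtensor X) y = 0.
Proof.
have := tensY_linearl y 1 (0 : mtensor X) 0; rewrite scaler0 addr0 scale1r => /eqP.
by rewrite -subr_eq0 opprD addNKr oppr_eq0 => /eqP.
Qed.

Lemma tensY0r a : tensY a (0 : Y) = 0.
Proof.
have := tensY_linearr a 1 (0 : Y) 0; rewrite scaler0 addr0 scale1r => /eqP.
by rewrite -subr_eq0 opprD addNKr oppr_eq0 => /eqP.
Qed.

Lemma tensYZl c a y : tensY (c *: a) y = c *: tensY a y.
Proof. by have := tensY_linearl y c a 0; rewrite !addr0 tensY0l addr0. Qed.

Lemma tensYZr c a y : tensY a (c *: y) = c *: tensY a y.
Proof. by have := tensY_linearr a c y 0; rewrite !addr0 tensY0r addr0. Qed.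

Lemma tensYDl a b y : tensY (a + b) y = tensY a y + tensY b y.
Proof. by have := tensY_linearl y 1 a b; rewrite !scale1r. Qed.

Definition representation (m : nat) (lam : 'I_m -> K) (a b : 'I_m -> mtensor X)
    (y : 'I_m -> Y) (u : tensorY X Y) : Prop :=
  [/\ forall i, decomposable (a i), forall i, decomposable (b i) &
      u = \sum_(i < m) lam i *: tensY (a i - b i) (y i)].

(** Zero is decomposable, so every elementary tensor is an admissible difference. Hence the infimum
    that defines the Lapreste norm runs over a nonempty set. *)
Lemma representation_exists (u : tensorY X Y) : exists m (lam : 'I_m -> K)
    (a b : 'I_m -> mtensor X) (y : 'I_m -> Y), representation lam a b y u.
Proof.
pose term (c : K * mtensor X * mtensor X * Y) := c.1.1.1 *: tensY (c.1.1.2 - c.1.2) c.2.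
suff [m [c [cd ->]]] : exists m (c : 'I_m -> K * mtensor X * mtensor X * Y),
    (forall i, decomposable (c i).1.1.2 /\ decomposable (c i).1.2) /\
    u = \sum_(i < m) term (c i).
  exists m, (fun i => (c i).1.1.1), (fun i => (c i).1.1.2), (fun i => (c i).1.2),
    (fun i => (c i).2); split=> // i; by have [] := cd i.
pose rep u := exists m (c : 'I_m -> K * mtensor X * mtensor X * Y),
    (forall i, decomposable (c i).1.1.2 /\ decomposable (c i).1.2) /\
    u = \sum_(i < m) term (c i).
have rep0 : rep 0.
  exists 0%N, (fun=> (0, 0, 0, 0)); rewrite big_ord0; split=> // i.
  by split; exact: decomposable0.
have repD v w : rep v -> rep w -> rep (v + w).
  move=> [m [c [cd ->]]] [l [d [dd ->]]].
  exists (m + l)%N, (fun i => match fintype.split i with inl j => c j | inr j => d j end).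
  split=> [i|]; first by case: fintype.split.
  rewrite big_split_ord/=; congr (_ + _); apply: eq_bigr => i _.
    by rewrite (unsplitK (inl i)).
  by rewrite (unsplitK (inr i)).
have [l ->] := tensor_gen u; apply: (big_ind rep) => // -[c [v y]] _.
have [m [x ->]] := mtensor_rep n0 v.
have -> : c *: tens (bilinear_forms (mtensor X) Y) (\sum_(j < m) mtens (x j), y) =
    \sum_(j < m) c *: tensY (mtens (x j)) y.
  rewrite -scaler_sumr; congr (_ *: _).
  exact: (big_morph (fun v => tensY v y) (fun a b => tensYDl a b y) (tensY0l y)).
apply: (big_ind rep) => // j _.
exists 1%N, (fun=> (c, mtens (x j), 0, y)); split=> [i|].
  by split; [exists (x j)|exact: decomposable0].
by rewrite big_ord1 /term/= subr0.
Qed.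

Section Sides.
Variables (A : set (wstar_mdual X)) (A0 : A !=set0).
Variables (B : set (wstar_dual Y)) (B0 : B !=set0).
Hypotheses (AX : A `<=` mball X) (nA : norming (cpair X) (cnorm X) A).
Hypotheses (BY : B `<=` bdual_ball Y)
  (nB : norming (bdual_pair Y) (fun y => (nrm y)%:E) B).

Definition iotaA (x : subspace_of A0) : mdual X := \val x.
Definition iotaB (x : subspace_of B0) : bdual Y := \val x.

Lemma mpair_lin (psi : mdual X) (c : K) a b :
  mpair psi (c *: a + b) = c * mpair psi a + mpair psi b.
Proof. by []. Qed.

Lemma iotaA_ball x : mball X (iotaA x).
Proof. by apply: AX; exact: set_valP. Qed.

Lemma iotaB_ball x : bdual_ball Y (iotaB x).
Proof. by apply: BY; exact: set_valP. Qed.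

Lemma iotaA_cont a : continuous (fun x => mpair (iotaA x) a : K^o).
Proof.
exact: (@subspace_of_continuous _ A A0 _ (fun psi : wstar_mdual X => mpair psi a : K^o)
  (@mpair_continuous R k n n0 X a)).
Qed.

Lemma iotaB_cont y : continuous (fun x => bdual_pair Y (iotaB x) y : K^o).
Proof.
exact: (@subspace_of_continuous _ B B0 _ (fun f : wstar_dual Y => bdual_pair Y f y : K^o)
  (@wstar_continuous R k _ _ (bdual_pair Y) y)).
Qed.

Lemma iotaA_norming a (e : R) : 0 < e -> exists x, pn a - e <= nrm (mpair (iotaA x) a).
Proof.
move=> e0; have [psi Apsi psia] := norming_adherent n0 a nA e0.
by exists (exist _ psi (mem_set Apsi)).
Qed.

Lemma iotaB_norming y (e : R) :
  0 < e -> exists x, nrm y - e <= nrm (bdual_pair Y (iotaB x) y : K).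
Proof.
move=> e0; have [_ /(_ y) yB] := nB.
have [|_ [f Bf <-]] := @ub_ereal_sup_adherent _
   [set (nrm (bdual_pair Y f y : K))%:E | f in B] e e0 _; first by rewrite -yB.
rewrite -yB -EFinB lte_fin => /ltW fy.
by exists (exist _ f (mem_set Bf)).
Qed.

Lemma bdual_lin (f : bdual Y) (c : K) y z :
  bdual_pair Y f (c *: y + z) = c * bdual_pair Y f y + bdual_pair Y f z.
Proof. exact: bdual_linear. Qed.

Lemma weak_tensorE m (a b : 'I_m -> mtensor X) :
  weak_lnorm_tensor s a b =
  weak_sup (mball X) (fun psi : mdual X => mpair psi) s (fun i => a i - b i).
Proof. by []. Qed.

Lemma weak_dualE m (y : 'I_m -> Y) :
  weak_lnorm t y = weak_sup (bdual_ball Y) (fun f : bdual Y => bdual_pair Y f) t y.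
Proof. by []. Qed.

Lemma weak_tensor_fin m (a b : 'I_m -> mtensor X) :
  exists2 W : R, 0 <= W & weak_lnorm_tensor s a b = W%:E.
Proof.
rewrite weak_tensorE; apply: (weak_sup_fin (T := subspace_of A0) (iota := iotaA)
  (@pn_ge0 _ _ _ n0 X) _ iotaA_ball _ s1).
by move=> psi v; exact: mpair_le.
Qed.

Lemma weak_dual_fin m (y : 'I_m -> Y) :
  exists2 W : R, 0 <= W & weak_lnorm t y = W%:E.
Proof.
rewrite weak_dualE; apply: (weak_sup_fin (T := subspace_of B0) (iota := iotaB)
  (@nrm_ge0 _ _ Y) _ iotaB_ball _ t1).
by move=> f v; exact: bdual_ball_le.
Qed.

(** The pivot between boundedness and domination: stated for individual representations, it keeps
    the infimum out of the arguments with measures. *)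
Definition bound_on_representations (C : R) : Prop :=
  forall m (lam : 'I_m -> K) (a b : 'I_m -> mtensor X) (y : 'I_m -> Y) (u : tensorY X Y),
    representation lam a b y u ->
    ((nrm (zeta u : K))%:E <= C%:E * ((lnorm r lam)%:E
              * weak_lnorm_tensor s a b * weak_lnorm t y))%E.

Section Domination.
Variables (mu : probability (borel_of (subspace_of A0)) R)
  (nu : probability (borel_of (subspace_of B0)) R).

Local Notation normA :=
  (side_norm (@pn R k n X) (fun psi : mdual X => mpair psi) iotaA mu s).
Local Notation normB :=
  (side_norm (fun y : Y => nrm y) (fun f : bdual Y => bdual_pair Y f) iotaB nu t).

Lemma normAE a b :
  (if q == 1%E then proj_norm (a - b) else
   'N[mu]_s[(fun psi => (nrm (mpair (\val psi) a - mpair (\val psi) b))%:E)])%E =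
  (normA (a - b))%:E.
Proof.
case: ifPn => [/eqP ->|q1]; first by rewrite hoelder_conjugate1 proj_normE.
have [s' s'1 ->] : exists2 s' : R, 1 <= s' & s = s'%:E.
  move: s1 => /=; case E : s => [s'||//]; first by exists s'.
  by move/hoelder_conjugate_eqy : E q1 => ->; rewrite eqxx.
by rewrite -(@side_normE _ _ _ _ _ _ _ _ iotaA (@pn_ge0 _ _ _ n0 X)
  (fun psi v => @mpair_le _ _ _ n0 X psi v) iotaA_ball iotaA_cont).
Qed.

Lemma normBE y :
  (if p == 1%E then (nrm y)%:E else
   'N[nu]_t[(fun f => (nrm (bdual_pair Y (\val f) y : K))%:E)])%E = (normB y)%:E.
Proof.
case: ifPn => [/eqP ->|p1]; first by rewrite hoelder_conjugate1.
have [s' s'1 ->] : exists2 s' : R, 1 <= s' & t = s'%:E.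
  move: t1 => /=; case E : t => [s'||//]; first by exists s'.
  by move/hoelder_conjugate_eqy : E p1 => ->; rewrite eqxx.
by rewrite -(@side_normE _ _ _ _ _ _ _ _ iotaB (@nrm_ge0 _ _ Y)
  (fun f v => @bdual_ball_le _ _ Y f v) iotaB_ball iotaB_cont).
Qed.

Lemma dominated_bound (C : R) : 0 <= C -> lapreste_dominated p q zeta C mu nu ->
  bound_on_representations C.
Proof.
move=> C0 dom m lam a b y u [ad bd ->].
have [W1 W10 W1E] := weak_tensor_fin a b.
have [W2 W20 W2E] := weak_dual_fin y.
pose f i := normA (a i - b i); pose g i := normB (y i).
have f0 i : 0 <= f i by apply: side_norm_ge0; exact: pn_ge0.
have g0 i : 0 <= g i by apply: side_norm_ge0; exact: nrm_ge0.
have fW : lnorm s (fun i => of_real k (f i)) <= W1.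
  rewrite -lee_fin -W1E weak_tensorE.
  apply: (lnorm_side_norm_le (@pn_ge0 _ _ _ n0 X) _ iotaA_ball iotaA_cont iotaA_norming _ _ s1).
  by move=> psi v; exact: mpair_le.
have gW : lnorm t (fun i => of_real k (g i)) <= W2.
  rewrite -lee_fin -W2E weak_dualE.
  apply: (lnorm_side_norm_le (@nrm_ge0 _ _ Y) _ iotaB_ball iotaB_cont iotaB_norming _ _ t1).
  by move=> psi v; exact: bdual_ball_le.
have term i : nrm (zeta (tensY (a i - b i) (y i)) : K) <= C * f i * g i.
  by have := dom _ _ (y i) (ad i) (bd i); rewrite normAE normBE -!EFinM lee_fin.
rewrite W1E W2E -!EFinM lee_fin linear_sum.
apply: le_trans (nrm_sum _ _) _.
apply: (@le_trans _ _ (C * \sum_(i < m)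
    nrm (lam i) * nrm (of_real k (f i)) * nrm (of_real k (g i)))).
  rewrite mulr_sumr; apply: ler_sum => i _.
  rewrite linearZ/= nrm_scalarM !nrm_of_real !ger0_norm//.
  have -> : C * (nrm (lam i) * f i * g i) = nrm (lam i) * (C * f i * g i) by ring.
  by rewrite ler_wpM2l ?nrm_ge0.
rewrite ler_wpM2l// (le_trans (hoelder3 _ _ _ r1 s1 t1 recip_sum))//.
apply: ler_pM; rewrite ?mulr_ge0 ?lnorm_ge0//.
by rewrite ler_wpM2l ?lnorm_ge0.
Qed.

End Domination.

Lemma representations_dominated (D : R) : compact A -> compact B -> 0 <= D ->
  bound_on_representations D -> domination_constant p q zeta A0 B0 D.
Proof.
move=> cA cB D0 bD; split=> //.
pose admA := admissible (@pn R k n X) s.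
pose admB := admissible (fun y : Y => nrm y) t.
pose J := {x : mtensor X * mtensor X * Y | [/\ decomposable x.1.1, decomposable x.1.2,
  admA (x.1.1 - x.1.2) & admB x.2]}.
pose g (j : J) := pow_pair (fun psi : mdual X => mpair psi) iotaA s ((sval j).1.1 - (sval j).1.2).
pose h (j : J) := pow_pair (fun f : bdual Y => bdual_pair Y f) iotaB t (sval j).2.
pose z (j : J) : R := nrm (zeta (tensY ((sval j).1.1 - (sval j).1.2) (sval j).2) : K).
have [r0 s0 t0] : [/\ 0 <= recip r, 0 <= recip s & 0 <= recip t].
  by split; exact: recip_ge0.
have [||||j|j|j x|j y|l l0 e e0|mu [nu [rmu rnu mn]]] := @domination_of_sums R (subspace_of A0)
  (subspace_of B0) J g h z _ _ _ _ _ _ _ _ D (recip r) (recip s) (recip t) D0 s0 t0.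
- exact: subspace_of_compact.
- exact/subspace_of_hausdorff/wstar_mdual_hausdorff.
- exact: subspace_of_compact.
- exact/subspace_of_hausdorff/wstar_dual_hausdorff.
- by apply: pow_pair_continuous => //; exact: iotaA_cont.
- by apply: pow_pair_continuous => //; exact: iotaB_cont.
- exact: pow_pair_ge0.
- exact: pow_pair_ge0.
- pose m := size l; pose w (i : 'I_m) := (tnth (in_tuple l) i).1.
  pose j (i : 'I_m) := (tnth (in_tuple l) i).2.
  have w0 i : 0 <= w i by move: l0 => /(all_tnthP (t := in_tuple l)); exact.
  pose a i := (sval (j i)).1.1; pose b i := (sval (j i)).1.2; pose y i := (sval (j i)).2.
  have [S1 [S10 S1e S1w]] := weak_sup_weighted (@pn_ge0 _ _ _ n0 X) mpair_lin
    (fun psi v => @mpair_le _ _ _ n0 X psi v) iotaA_ball iotaA_norming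
    (v := fun i => a i - b i) s1 w0 (fun i => let: And4 _ _ h _ := svalP (j i) in h).
  have [S2 [S20 S2e S2w]] := weak_sup_weighted (@nrm_ge0 _ _ Y) bdual_lin
    (fun f v => @bdual_ball_le _ _ Y f v) iotaB_ball iotaB_norming
    (v := y) t1 w0 (fun i => let: And4 _ _ _ h := svalP (j i) in h).
  have /choice[c cE] : forall i, exists c : K, nrm c = 1 /\
      c * (zeta (tensY (a i - b i) (y i)) : K) = of_real k (z (j i)).
    move=> i; have [c ? ?] := unimodularP (zeta (tensY (a i - b i) (y i)) : K).
    by exists c.
  (* Together with [ws] and [wt] below, [lam] splits the weight [w i] into three powers with product
     [w i]; the phase [c i] turns the value of [zeta] on each term into its modulus, so that nothing
     cancels in [zeta u]. *)
  pose lam i := c i * of_real k (w i `^ recip r).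
  pose ws i := of_real k (w i `^ recip s); pose wt i := of_real k (w i `^ recip t).
  pose u := \sum_(i < m) lam i *: tensY (ws i *: a i - ws i *: b i) (wt i *: y i).
  have rep : representation lam (fun i => ws i *: a i) (fun i => ws i *: b i)
      (fun i => wt i *: y i) u.
    by split=> // i; have [? ? _ _] := svalP (j i); exact: decomposableZ.
  have zu : (zeta u : K) = of_real k (\sum_(i < m) w i * z (j i)).
    rewrite /u linear_sum (big_morph _ (@of_realD R k) (@of_real0 R k)).
    apply: eq_bigr => i _; rewrite -scalerBr tensYZl tensYZr !linearZ/= /lam /ws /wt.
    have [_ ci] := cE i.
    rewrite [RHS]of_realM -ci -{4}(powR_split3 recip_sum (w0 i)) !of_realM.
    by ring.
  have wz : \sum_(i < m) w i * z (j i) <= nrm (zeta u : K).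
    by rewrite zu nrm_of_real ler_norm.
  have lamW : lnorm r lam <= (\sum_(i < m) w i) `^ recip r.
    have nlam i : nrm (lam i) = w i `^ recip r.
      have [ci _] := cE i.
      by rewrite /lam nrm_scalarM ci mul1r nrm_of_real ger0_norm// powR_ge0.
    case: (r) r1 nlam => [r'|_|//] => [r'1|] nlam.
      rewrite lee_fin in r'1; have r'0 : 0 < r' by exact: lt_le_trans ltr01 r'1.
      rewrite lnorm_fin (eq_bigr w) ?recip_fin// => i _.
      by rewrite nlam recip_fin// -powRrM mulVf ?gt_eqF// powRr1.
    rewrite lnorm_y recip_y powRr0; apply: bigmax_le => // i _.
    by rewrite nlam recip_y powRr0.
  have W0 : 0 <= \sum_(i < m) w i by exact: sumr_ge0.
  have main : \sum_(i < m) w i * z (j i) <=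
      D * (recip r * \sum_(i < m) w i + recip s * S1 + recip t * S2).
    apply: (le_trans wz); have := bD _ _ _ _ _ _ rep.
    have -> : weak_lnorm_tensor s (fun i => ws i *: a i) (fun i => ws i *: b i) =
        weak_sup (mball X) (fun psi : mdual X => mpair psi) s (fun i => ws i *: (a i - b i)).
      by rewrite weak_tensorE; congr weak_sup; apply/funext => i; rewrite scalerBr.
    rewrite weak_dualE => /le_trans bDu; rewrite -lee_fin; apply: bDu.
    rewrite EFinM lee_wpmul2l ?lee_fin//.
    apply: (@le_trans _ _ (((\sum_(i < m) w i) `^ recip r)%:E *
        (S1 `^ recip s)%:E * (S2 `^ recip t)%:E)%E).
      apply: lee_pmul.
      + rewrite mule_ge0// ?lee_fin ?lnorm_ge0//.
        apply: le_trans (weak_sup_ub _ _ _ (iotaA_ball point)); rewrite lee_fin.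
        exact: lnorm_ge0.
      + apply: le_trans (weak_sup_ub _ _ _ (iotaB_ball point)); rewrite lee_fin.
        exact: lnorm_ge0.
      + apply: lee_pmul; rewrite ?lee_fin ?lnorm_ge0//.
        apply: le_trans (weak_sup_ub _ _ _ (iotaA_ball point)); rewrite lee_fin.
        exact: lnorm_ge0.
      + exact: S2w.
    by rewrite -!EFinM lee_fin weighted_amgm3.
  (* The errors in [S1] and [S2] enter with the factor [D * (recip s + recip t)], which is at most
     [D]; the added 1 covers [D = 0]. *)
  have e'0 : 0 < e / (D + 1) by rewrite divr_gt0// ltr_wpDl.
  have [x xS] := S1e _ e'0; have [x' xS'] := S2e _ e'0.
  exists x, x'; rewrite !(big_tnth _ _ l).
  apply: le_trans main _.
  set G := \sum_(i < m) w i * pow_pair _ _ s _ _ in xS.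
  set H := \sum_(i < m) w i * pow_pair _ _ t _ _ in xS'.
  apply: (@le_trans _ _ (D * (recip r * \sum_(i < m) w i + recip s * (G + e / (D + 1)) +
      recip t * (H + e / (D + 1))))).
    by rewrite ler_wpM2l// !lerD// ler_wpM2l.
  rewrite (_ : D * _ = D * (recip r * \sum_(i < m) w i + recip s * G + recip t * H) +
      D * (recip s + recip t) * (e / (D + 1))); last by ring.
  rewrite lerD2l.
  apply: (@le_trans _ _ (D * (e / (D + 1)))).
    rewrite ler_wpM2r ?(ltW e'0)// -[leRHS]mulr1 ler_wpM2l// -recip_sum -addrA lerDr.
    exact: r0.
  rewrite mulrA ler_pdivrMr ?ltr_wpDl// mulrC ler_pM2l// lerDl; exact: ler01.
exists mu, nu; split=> // a b y da db.
rewrite normAE normBE -!EFinM lee_fin.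
set M := side_norm _ _ _ _ _ _; set N := side_norm _ _ _ _ _ _.
have M0 : 0 <= M by apply: side_norm_ge0; exact: pn_ge0.
have N0 : 0 <= N by apply: side_norm_ge0; exact: nrm_ge0.
have -> : D * M * N = M * (D * N) by ring.
(* Either side norm may vanish, so each is replaced by a strictly larger divisor. *)
apply: le_of_forall_gt_mul => [||M' MM'] //.
  exact: mulr_ge0.
have M'0 : 0 < M' by exact: le_lt_trans MM'.
have -> : M' * (D * N) = N * (M' * D) by ring.
apply: le_of_forall_gt_mul => [||N' NN'] //.
  by rewrite mulr_ge0// ltW.
have N'0 : 0 < N' by exact: le_lt_trans NN'.
have [aA iA] := normalise_side_norm (@pn_ge0 _ _ _ n0 X) (@pnZ _ _ _ n0 X) mpair_lin
  (fun psi v => @mpair_le _ _ _ n0 X psi v) iotaA_ball iotaA_cont s1 MM'.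
have [aB iB] := normalise_side_norm (@nrm_ge0 _ _ Y) (@nrmZ _ _ Y) bdual_lin
  (fun f v => @bdual_ball_le _ _ Y f v) iotaB_ball iotaB_cont t1 NN'.
have jP : [/\ decomposable (of_real k M'^-1 *: a), decomposable (of_real k M'^-1 *: b),
    admA (of_real k M'^-1 *: a - of_real k M'^-1 *: b) & admB (of_real k N'^-1 *: y)].
  by split; rewrite -?scalerBr//; exact: decomposableZ.
pose j : J := exist _ (of_real k M'^-1 *: a, of_real k M'^-1 *: b, of_real k N'^-1 *: y) jP.
have zj : z j = M'^-1 * (N'^-1 * nrm (zeta (tensY (a - b) y) : K)).
  rewrite /z /= -scalerBr tensYZl tensYZr !linearZ/= !nrm_scalarM !nrm_of_real.
  by rewrite !ger0_norm// invr_ge0 ltW.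
(* At the normalised arguments the bracket of the additive inequality is at most
   [recip r + recip s + recip t = 1], which is why the constant stays [D]. *)
have : z j <= D.
  rewrite -lee_fin; apply: le_trans (mn j) _.
  rewrite -[leRHS]mule1 lee_wpmul2l ?lee_fin//.
  rewrite -recip_sum !EFinD; apply: leeD; last exact: iB.
  by apply: leeD => //; rewrite /g/= -scalerBr; exact: iA.
by rewrite zj ler_pdivrMl// ler_pdivrMl.
Qed.

(* Representations of zero Lapreste size cannot be normalised; the functional
   vanishes on them by boundedness. *)
Lemma lapreste_dual_norm_bound : lapreste_bounded p q zeta ->
  exists D : R, [/\ lapreste_dual_norm p q zeta = D%:E, 0 <= D &
    bound_on_representations D].
Proof.
move=> [C0 zC0]; pose C := Order.max 0 C0.
have C_ge0 : 0 <= C by rewrite /C le_max lexx.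
have lapr m (lam : 'I_m -> K) (a b : 'I_m -> mtensor X) (y : 'I_m -> Y) (u : tensorY X Y) :
    representation lam a b y u -> (lapreste_norm p q u <=
      (lnorm r lam)%:E * weak_lnorm_tensor s a b * weak_lnorm t y)%E.
  by move=> [ad bd ->]; apply: ereal_inf_lbound; exists m, lam, a, b, y.
have lap0 (u : tensorY X Y) : (0 <= lapreste_norm p q u)%E.
  apply: le_ereal_inf_tmp => _ [m [lam [a [b [y [_ _ _ ->]]]]]].
  have [W1 W10 ->] := weak_tensor_fin a b; have [W2 W20 ->] := weak_dual_fin y.
  by rewrite -!EFinM lee_fin !mulr_ge0// lnorm_ge0.
have zC (u : tensorY X Y) : ((nrm (zeta u : K))%:E <= C%:E * lapreste_norm p q u)%E.
  by apply: le_trans (zC0 u) _; rewrite lee_wpmul2r// lee_fin /C le_max lexx orbT.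
have scale_rep m (lam : 'I_m -> K) (a b : 'I_m -> mtensor X) (y : 'I_m -> Y)
    (u : tensorY X Y) (c : K) : representation lam a b y u ->
    representation (fun i => c * lam i) a b y (c *: u).
  move=> [ad bd ->]; split=> //; rewrite scaler_sumr.
  by apply: eq_bigr => i _; rewrite scalerA.
have z0 : (zeta 0 : K) = 0 by rewrite linear0.
have lapr0 : (lapreste_norm p q (0 : tensorY X Y) <= 1)%E.
  have [m [lam [a [b [y rep]]]]] := representation_exists 0.
  have /lapr := scale_rep _ _ _ _ _ _ 0 rep; rewrite scaler0 => /le_trans; apply.
  have [W1 W10 ->] := weak_tensor_fin a b; have [W2 W20 ->] := weak_dual_fin y.
  by rewrite lnorm_scale// nrm0 -!EFinM !mul0r lee_fin.
have Dub : (lapreste_dual_norm p q zeta <= C%:E)%E.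
  apply: ge_ereal_sup => _ [u /= u1 <-]; apply: le_trans (zC u) _.
  by rewrite -[leRHS]mule1 lee_wpmul2l// lee_fin.
have D0 : (0 <= lapreste_dual_norm p q zeta)%E.
  apply: ereal_sup_ubound; exists 0 => //.
  by rewrite z0 nrm0.
have Dfin : lapreste_dual_norm p q zeta \is a fin_num.
  by rewrite ge0_fin_numE// (le_lt_trans Dub)// ltry.
exists (fine (lapreste_dual_norm p q zeta)); split; first by rewrite fineK.
  exact: fine_ge0.
move=> m lam a b y u rep; rewrite fineK//.
have := lapr _ _ _ _ _ _ rep.
have := scale_rep _ _ _ _ _ _ _ rep.
have [W1 W10 W1E] := weak_tensor_fin a b; have [W2 W20 W2E] := weak_dual_fin y.
rewrite W1E W2E -!EFinM; set L := lnorm r lam * W1 * W2 => srep uL.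
have : 0 <= L by rewrite !mulr_ge0// lnorm_ge0.
rewrite le_eqVlt => /predU1P[L0|L0].
  rewrite -L0 mule0; apply: le_trans (zC u) _.
  have -> : lapreste_norm p q u = 0%E.
    by apply/eqP; rewrite eq_le lap0 andbT; move: uL; rewrite -L0.
  by rewrite mule0.
have LV0 : 0 <= L^-1 by rewrite invr_ge0 ltW.
have uL1 : (lapreste_norm p q (of_real k L^-1 *: u) <= 1)%E.
  have /lapr := srep (of_real k L^-1); rewrite W1E W2E -!EFinM => /le_trans; apply.
  rewrite lnorm_scale// nrm_of_real ger0_norm// -!mulrA (mulrA (lnorm _ _)) mulVf//.
  by rewrite gt_eqF.
have : ((nrm (zeta (of_real k L^-1 *: u) : K))%:E <= lapreste_dual_norm p q zeta)%E.
  by apply: ereal_sup_ubound; exists (of_real k L^-1 *: u).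
rewrite linearZ/= nrm_scalarM nrm_of_real ger0_norm// -(fineK Dfin) -EFinM !lee_fin.
by rewrite ler_pdivrMl// mulrC.
Qed.

Lemma bound_on_representations_norm (C : R) : 0 <= C -> bound_on_representations C ->
  forall u, ((nrm (zeta u : K))%:E <= C%:E * lapreste_norm p q u)%E.
Proof.
move=> C0 bC u; have [m [lam [a [b [y rep]]]]] := representation_exists u.
have [W1 W10 W1E] := weak_tensor_fin a b; have [W2 W20 W2E] := weak_dual_fin y.
(* For [C = 0] a single representation settles the claim; for positive [C] division by [C] produces
   a lower bound of the infimum. *)
move: C0; rewrite le_eqVlt => /predU1P[C0|C0].
  by have := bC _ _ _ _ _ _ rep; rewrite -C0 !mul0e.
rewrite muleC -lee_pdivrMr// muleC; apply: le_ereal_inf_tmp => _ [l [lam' [a' [b' [y' [ad bd uE ->]]]]]].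
have rep' : representation lam' a' b' y' u by [].
by rewrite muleC lee_pdivrMr// muleC; exact: bC rep'.
Qed.

Lemma domination_constant_bound (C : R) : domination_constant p q zeta A0 B0 C ->
  forall u, ((nrm (zeta u : K))%:E <= C%:E * lapreste_norm p q u)%E.
Proof.
move=> [C0 [mu [nu [_ _ dom]]]]; apply: bound_on_representations_norm => //.
exact: dominated_bound dom.
Qed.

(** The dual norm [D] is itself a domination constant, so the infimum is attained; conversely, every
    domination constant bounds [zeta] on the unit ball of the Lapreste norm. *)
Lemma lapreste_dual_normE : compact A -> compact B -> lapreste_bounded p q zeta ->
  (exists C : R, domination_constant p q zeta A0 B0 C) /\
  lapreste_dual_norm p q zeta =
    ereal_inf [set C%:E | C in domination_constant p q zeta A0 B0].
Proof.
move=> cA cB bz; have [D [DE D0 bD]] := lapreste_dual_norm_bound bz.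
have dD := representations_dominated cA cB D0 bD.
split; first by exists D.
apply/eqP; rewrite eq_le; apply/andP; split; last first.
  by rewrite DE; apply: ereal_inf_lbound; exists D.
apply: le_ereal_inf_tmp => _ [C dC <-]; apply: ge_ereal_sup => _ [u /= u1 <-].
apply: le_trans (domination_constant_bound dC u) _.
by rewrite -[leRHS]mule1 lee_wpmul2l// lee_fin; case: dC.
Qed.

End Sides.

End Laprest.

Theorem theorem2p3 (R : realType) (k : field_kind) (p q : \bar R)
    (hp : (1 <= p)%E) (hq : (1 <= q)%E) (hpq : (1 <= p^-1 + q^-1)%E)
    (n : nat) (hn : (0 < n)%N)
    (X : 'I_n -> completeNormedModType (scalars R k))
    (Y : completeNormedModType (scalars R k))
    (zeta : {scalar tensorY X Y}) :
  (lapreste_bounded p q zeta <->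
   forall (A : set (wstar_mdual X)) (B : set (wstar_dual Y))
     (A0 : A !=set0) (B0 : B !=set0),
     A `<=` mball X -> compact A -> norming (cpair X) (cnorm X) A ->
     B `<=` bdual_ball Y -> compact B ->
     norming (bdual_pair Y) (fun y => (nrm y)%:E) B ->
     exists C : R, domination_constant p q zeta A0 B0 C) /\
  (lapreste_bounded p q zeta ->
   forall (A : set (wstar_mdual X)) (B : set (wstar_dual Y))
     (A0 : A !=set0) (B0 : B !=set0),
     A `<=` mball X -> compact A -> norming (cpair X) (cnorm X) A ->
     B `<=` bdual_ball Y -> compact B ->
     norming (bdual_pair Y) (fun y => (nrm y)%:E) B ->
     lapreste_dual_norm p q zeta =
       ereal_inf [set C%:E | C in domination_constant p q zeta A0 B0]).
Proof.
have key := fun A B A0 B0 AX cA nA BY cB nB =>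
  @lapreste_dual_normE R k p q hp hq hpq n hn X Y zeta A A0 B B0 AX nA BY nB cA cB.
split; last first.
  by move=> bz A B A0 B0 AX cA nA BY cB nB; have [] := key A B A0 B0 AX cA nA BY cB nB bz.
split=> [bz A B A0 B0 AX cA nA BY cB nB|dom].
  by have [] := key A B A0 B0 AX cA nA BY cB nB bz.
have nX := mball_cnorming hn X; have nY := bdual_ball_norming Y.
have [C dC] := dom _ _ nX.1 nY.1 (fun _ h => h) (@mball_compact R k n hn X) nX
  (fun _ h => h) (@bdual_ball_compact R k Y) nY.
by exists C; apply: (domination_constant_bound hp hq hpq hn _ nX _ nY dC).
Qed.
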